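(* Let $n\ge 1$ and let $\mathcal{C}_n$ be the space of Coxeter systems of rank $n$, with the topology induced from the space $\mathcal{G}_n$ of $n$-marked groups. Then the growth rate $\omega:\mathcal{C}_n\to\mathbb{R}_{\ge 1}$, $(G,S)\mapsto\omega(G,S)$, is a continuous function.
   Context: An $n$-marked group is a pair $(G,S)$ where $G$ is a group and $S=(s_1,\dots,s_n)$ is an ordered generating set of $G$. Two $n$-marked groups $(G,S)$, $(H,T)$ are isomorphic if $s_i\mapsto t_i$ extends to a group isomorphism $G\to H$; $\mathcal{G}_n$ is the set of isomorphism classes. Let $\mathbb{F}_n$ be the free group on $X=(x_1,\dots,x_n)$, let $\pi_{(G,S)}:\mathbb{F}_n\to G$ be the epimorphism with $x_i\mapsto s_i$, and let $B(R)$ be the ball of radius $R$ centered at $1$ in $\mathbb{F}_n$ for the word length with respect to $X$. Put $v((G,S),(H,T))=\max\{R\ge 0: B(R)\cap\ker\pi_{(G,S)}=B(R)\cap\ker\pi_{(H,T)}\}$ ($R$ integer; $v=\infty$ if the kernels coincide). The metric on $\mathcal{G}_n$ is $d((G,S),(H,T))=e^{-v((G,S),(H,T))}$ (with $e^{-\infty}=0$). Let $\widehat{\mathbb{N}}=\{1,2,3,\dots\}\cup\{\infty\}$. A Coxeter matrix of size $n\times n$ is a symmetric matrix $M=(m_{ij})$ over $\widehat{\mathbb{N}}$ with $m_{ij}=1$ if and only if $i=j$. It determines the group $G(M)=\langle s_1,\dots,s_n\mid (s_is_j)^{m_{ij}}=1 \text{ for } 1\le i\le j\le n\rangle$ (no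 relation when $m_{ij}=\infty$). The marked group $(G(M),(s_1,\dots,s_n))$ is called a Coxeter system of rank $n$; $\mathcal{C}_n\subset\mathcal{G}_n$ is the set of all (isomorphism classes of) Coxeter systems of rank $n$ with the subspace topology. For a marked group $(G,S)$, $|x|_S$ is the word length of $x\in G$ with respect to $S\cup S^{-1}$ (with $|1_G|_S=0$), $s_{(G,S)}(m)=\#\{x\in G: |x|_S\le m\}$, and the growth rate is $\omega(G,S)=\lim_{m\to\infty}\sqrt[m]{s_{(G,S)}(m)}$ (the limit exists since $s_{(G,S)}$ is submultiplicative). *)

(* Defs.v *)
From HB Require Import structures.
From mathcomp Require Import all_boot all_order all_algebra finmap.
From mathcomp Require Import all_classical all_reals all_analysis.

Set Implicit Arguments.
Unset Strict Implicit.
Unset Printing Implicit Defensive.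

Import Order.TTheory GRing.Theory Num.Theory.
Import numFieldNormedType.Exports.

Local Open Scope classical_set_scope.

(* A letter [(i, b)] stands for the generator [x_i] if [b = false] and for its
   inverse if [b = true]. The indices are not in ['I_n], whose universe is too
   large for the free group to be the carrier of a [markedGroup] below. *)
Notation letter n := ({i : nat | (i < n)%N} * bool)%type.

Definition index_ord n (i : {i : nat | (i < n)%N}) : 'I_n := Ordinal (svalP i).
Definition ord_index n (i : 'I_n) : {i : nat | (i < n)%N} :=
  exist _ (val i) (ltn_ord i).

Fact ord_indexK n : cancel (@ord_index n) (@index_ord n).
Proof. by move=> i; exact: val_inj. Qed.

Fact index_ordK n : cancel (@index_ord n) (@ord_index n).
Proof. by move=> i; exact: val_inj. Qed.

Section FreeGroup.
Variable n : nat.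
Implicit Types (a b : letter n) (s t : seq (letter n)).

Definition inv_letter a : letter n := (a.1, ~~ a.2).

Definition reduced s : bool := sorted (fun a b => b != inv_letter a) s.

Record freeGroup : Set :=
  FreeWord { word_of : seq (letter n); reduced_word_of : reduced word_of }.

HB.instance Definition _ := [isSub for word_of].
HB.instance Definition _ := [Choice of freeGroup by <:].

(* The reduced form of [a :: s], for a reduced [s]. *)
Definition push a s : seq (letter n) :=
  if s is b :: t then if b == inv_letter a then t else a :: s else [:: a].

Definition word_mul s t : seq (letter n) := foldr push t s.

Definition word_inv s : seq (letter n) := rev (map inv_letter s).

Fact inv_letterK : involutive inv_letter.
Proof. by case=> i b; rewrite /inv_letter /= negbK. Qed.

Fact reduced_cons a s : reduced (a :: s) -> reduced s.
Proof. by case: s => //= b s /andP[]. Qed.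

Fact push_reduced a s : reduced (a :: s) -> push a s = a :: s.
Proof. by case: s => //= b s /andP[/negPf ->]. Qed.

Fact reduced_push a s : reduced s -> reduced (push a s).
Proof.
case: s => [|b s] //= red_s; case: eqVneq => [_|ba]; last by rewrite /= ba.
exact: (@reduced_cons b).
Qed.

Fact pushK a s : reduced s -> push a (push (inv_letter a) s) = s.
Proof.
case: s => [|b s] /=; first by rewrite eqxx.
rewrite inv_letterK; case: eqVneq => [->|ba] red_s; last by rewrite /= eqxx.
exact: push_reduced.
Qed.

Fact reduced_mul s t : reduced t -> reduced (word_mul s t).
Proof. by move=> red_t; elim: s => //= a s; exact: reduced_push. Qed.

Fact word_mul_push a s t : reduced t ->
  word_mul (push a s) t = push a (word_mul s t).
Proof.
case: s => //= b s red_t; case: eqP => //= ->.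
by rewrite pushK// reduced_mul.
Qed.

Fact word_mulA s t u : reduced u ->
  word_mul s (word_mul t u) = word_mul (word_mul s t) u.
Proof. by move=> red_u; elim: s => //= a s ->; rewrite word_mul_push. Qed.

Fact word_mul1 s : reduced s -> word_mul s [::] = s.
Proof.
elim: s => //= a s IHs red_as.
by rewrite IHs ?push_reduced//; exact: reduced_cons red_as.
Qed.

Fact word_invK : involutive word_inv.
Proof. by move=> s; rewrite /word_inv map_rev revK (mapK inv_letterK). Qed.

Fact reduced_inv s : reduced s -> reduced (word_inv s).
Proof.
rewrite /reduced /word_inv rev_sorted sorted_map.
apply: sub_sorted => a b /=; apply: contra_neq => /(can_inj inv_letterK) ->.
by rewrite inv_letterK.
Qed.

Fact word_mulV s : word_mul (word_inv s) s = [::].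
Proof.
elim: s => //= a s IHs.
by rewrite /word_inv /= rev_cons /word_mul foldr_rcons /= inv_letterK eqxx.
Qed.

Definition free_one : freeGroup := @FreeWord [::] isT.
Definition free_mul (u v : freeGroup) : freeGroup :=
  FreeWord (reduced_mul (word_of u) (reduced_word_of v)).
Definition free_inv (u : freeGroup) : freeGroup :=
  FreeWord (reduced_inv (reduced_word_of u)).

Fact free_mulA : associative free_mul.
Proof. by move=> u v w; apply: val_inj; exact/word_mulA/reduced_word_of. Qed.

Fact free_mul1g : left_id free_one free_mul.
Proof. by move=> u; exact: val_inj. Qed.

Fact free_mulg1 : right_id free_one free_mul.
Proof. by move=> u; apply: val_inj; exact/word_mul1/reduced_word_of. Qed.

Fact free_mulVg : left_inverse free_one free_inv free_mul.
Proof. by move=> u; apply: val_inj; exact: word_mulV. Qed.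

Fact free_mulgV : right_inverse free_one free_inv free_mul.
Proof.
move=> u; apply: val_inj; rewrite /= -{1}[word_of u]word_invK.
exact: word_mulV.
Qed.

HB.instance Definition _ := isGroup.Build freeGroup
  free_mulA free_mul1g free_mulg1 free_mulVg free_mulgV.

Definition free_gen (i : 'I_n) : freeGroup := @FreeWord [:: (ord_index i, false)] isT.

End FreeGroup.

Definition generates (G : groupType) (n : nat) (s : 'I_n -> G) : Prop :=
  forall H : {pred G}, group_closed H -> (forall i, s i \in H) ->
  forall x, x \in H.

Fact free_gen_generates n : generates (@free_gen n).
Proof.
move=> H Hgrp Hgen [s red_s].
elim: s red_s => [|[i b] s IHs] red_s.
  by rewrite (_ : FreeWord _ = 1%g); [exact: Hgrp.1|exact: val_inj].
have red_s' := reduced_cons red_s.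
have red_i : reduced [:: (i, b)] by [].
rewrite (_ : FreeWord _ = (FreeWord red_i * FreeWord red_s')%g); last first.
  by apply: val_inj; rewrite /= push_reduced.
apply: (group_closedM Hgrp) (IHs _).
case: b {red_s} red_i => red_i.
  rewrite (_ : FreeWord _ = (free_gen (index_ord i))^-1%g); last first.
    by apply: val_inj; rewrite /= /inv_letter /= index_ordK.
  exact/(group_closedV Hgrp)/Hgen.
rewrite (_ : FreeWord _ = free_gen (index_ord i))//.
by apply: val_inj; rewrite /= index_ordK.
Qed.

Section Presentation.
Variables (n : nat) (rels : set (freeGroup n)).
Local Open Scope group_scope.

Definition normal_closure : set (freeGroup n) :=
  [set x | forall N : {pred freeGroup n}, group_closed N ->
     (forall y z, y \in N -> y ^ z \in N) ->
     (forall r, rels r -> r \in N) -> x \in N].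

Fact normal_closure1 : normal_closure 1.
Proof. by move=> N []. Qed.

Fact normal_closureM x y :
  normal_closure x -> normal_closure y -> normal_closure (x * y).
Proof.
move=> Nx Ny N Ngrp Nconj Nrels.
by apply: (group_closedM Ngrp); [exact: Nx|exact: Ny].
Qed.

Fact normal_closureV x : normal_closure x -> normal_closure x^-1.
Proof.
by move=> Nx N Ngrp Nconj Nrels; apply: (group_closedV Ngrp); exact: Nx.
Qed.

Fact normal_closureJ x y : normal_closure x -> normal_closure (x ^ y).
Proof. by move=> Nx N Ngrp Nconj Nrels; apply: (Nconj); exact: Nx. Qed.

(* The quotient of the free group by the normal closure of [rels], as the type
   of left cosets. *)
Definition lcoset_of (x : freeGroup n) : freeGroup n -> Prop :=
  fun y => normal_closure (x^-1 * y).

Definition presented : Type :=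
  {c : freeGroup n -> Prop | exists x, c = lcoset_of x}.

HB.instance Definition _ := gen_eqMixin presented.
HB.instance Definition _ := gen_choiceMixin presented.

Definition pres_pi (x : freeGroup n) : presented :=
  exist _ (lcoset_of x) (ex_intro _ x erefl).

Definition pres_repr (c : presented) : freeGroup n := projT1 (cid (svalP c)).

Fact pres_piP (x y : freeGroup n) :
  pres_pi x = pres_pi y <-> normal_closure (x^-1 * y).
Proof.
split=> [[] /(congr1 (@^~ y)) xy|xy].
  suff : lcoset_of x y by [].
  by rewrite xy /lcoset_of mulVg; exact: normal_closure1.
apply: eq_exist; apply/funext => z; apply/propext; split=> xz.
  have := normal_closureM (normal_closureV xy) xz.
  by rewrite invgM invgK mulgA mulgK.
by have := normal_closureM xy xz; rewrite mulgA mulgK.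
Qed.

Fact pres_reprK : cancel pres_repr pres_pi.
Proof.
move=> [c cP]; apply: eq_exist.
by rewrite /pres_repr; case: cid => /= x <-.
Qed.

Definition pres_one : presented := pres_pi 1.
Definition pres_mul (c d : presented) : presented :=
  pres_pi (pres_repr c * pres_repr d).
Definition pres_inv (c : presented) : presented := pres_pi (pres_repr c)^-1.

Fact pres_piM x y : pres_pi (x * y) = pres_mul (pres_pi x) (pres_pi y).
Proof.
apply/pres_piP; rewrite invgM -mulgA.
have /pres_piP xx := esym (pres_reprK (pres_pi x)).
have /pres_piP yy := esym (pres_reprK (pres_pi y)).
move: (pres_repr _) xx (pres_repr _) yy => x' xx' y' yy'.
have -> : y^-1 * (x^-1 * (x' * y')) = y^-1 * y' * (x^-1 * x') ^ y'.
  by rewrite /conjg !mulgA mulgK.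
by apply: normal_closureM => //; exact: normal_closureJ.
Qed.

Fact pres_piV x : pres_pi x^-1 = pres_inv (pres_pi x).
Proof.
apply/pres_piP; rewrite invgK.
have /pres_piP xx := pres_reprK (pres_pi x).
move: (pres_repr _) xx => x' xx'.
have -> : x * x'^-1 = (x'^-1 * x) ^ x'^-1 by rewrite /conjg invgK mulgA mulVKg.
exact: normal_closureJ.
Qed.

Fact pres_mulA : associative pres_mul.
Proof.
move=> c d e; rewrite -[c]pres_reprK -[d]pres_reprK -[e]pres_reprK.
by rewrite -!pres_piM mulgA.
Qed.

Fact pres_mul1g : left_id pres_one pres_mul.
Proof. by move=> c; rewrite -[c]pres_reprK -pres_piM mul1g. Qed.

Fact pres_mulg1 : right_id pres_one pres_mul.
Proof. by move=> c; rewrite -[c]pres_reprK -pres_piM mulg1. Qed.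

Fact pres_mulVg : left_inverse pres_one pres_inv pres_mul.
Proof. by move=> c; rewrite -[c]pres_reprK -pres_piV -pres_piM mulVg. Qed.

Fact pres_mulgV : right_inverse pres_one pres_inv pres_mul.
Proof. by move=> c; rewrite -[c]pres_reprK -pres_piV -pres_piM mulgV. Qed.

HB.instance Definition _ := isGroup.Build presented
  pres_mulA pres_mul1g pres_mulg1 pres_mulVg pres_mulgV.

Definition pres_gen (i : 'I_n) : presented := pres_pi (free_gen i).

Fact pres_gen_generates : generates pres_gen.
Proof.
move=> H Hgrp Hgen c; rewrite -[c]pres_reprK.
pose K : {pred freeGroup n} := [pred x | pres_pi x \in H].
have Kgrp : group_closed K.
  split=> [|x y]; rewrite !inE; first exact: Hgrp.1.
  by rewrite pres_piM pres_piV; exact: Hgrp.2.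
by apply: (@free_gen_generates n K Kgrp); exact: Hgen.
Qed.

End Presentation.

(* The carrier and the group structure are separate fields, because a field of
   type [groupType] would put [markedGroup] in a universe too large for the
   choice and topological structures below. The resulting bound on the universe
   of the carrier loses no isomorphism class, marked groups being countable. *)
Record markedGroup (n : nat) : Type := MarkedGroup {
  carrier : Type;
  group_struct : Group.axioms_ carrier;
  marking : 'I_n -> carrier;
  marking_generates : generates (marking : 'I_n -> Group.Pack group_struct)
}.

Definition group_of n (A : markedGroup n) : groupType :=
  Group.Pack (group_struct A).
Coercion group_of : markedGroup >-> Group.type.

Definition gen n (A : markedGroup n) : 'I_n -> A := @marking n A.

Definition free_marked n : markedGroup n :=
  MarkedGroup (@free_gen_generates n).

Definition presented_marked n (rels : set (freeGroup n)) : markedGroup n :=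
  MarkedGroup (@pres_gen_generates n rels).

Definition marked_iso n (A B : markedGroup n) : Prop :=
  exists f : A -> B,
    [/\ {morph f : x y / (x * y)%g}, bijective f & forall i, f (gen A i) = gen B i].

Section WordLength.
Variables (n : nat) (A : markedGroup n).
Local Open Scope group_scope.

Definition letter_val (a : letter n) : A :=
  if a.2 then (gen A (index_ord a.1))^-1 else gen A (index_ord a.1).

Definition word_val (s : seq (letter n)) : A := \prod_(a <- s) letter_val a.

Definition free_proj (u : freeGroup n) : A := word_val (word_of u).

Definition marked_ker : set (freeGroup n) := [set u | free_proj u = 1].

Definition has_word (x : A) : pred nat :=
  [pred m | `[< exists2 s, size s = m & word_val s = x >] ].

Fact word_val_cons a s : word_val (a :: s) = letter_val a * word_val s.
Proof. exact: big_cons. Qed.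

Fact word_val_push a s : word_val (push a s) = letter_val a * word_val s.
Proof.
case: s => [|b s] /=; first exact: word_val_cons.
case: eqP => [->|_]; last by rewrite !word_val_cons.
rewrite word_val_cons; case: a => i [] /=; rewrite /letter_val /=.
  by rewrite mulKg.
by rewrite mulVKg.
Qed.

Fact free_projM u v : free_proj (u * v) = free_proj u * free_proj v.
Proof.
rewrite /free_proj /=; elim: (word_of u) => [|a s IHs]; last first.
  by rewrite /= word_val_push IHs mulgA -word_val_cons.
by rewrite [word_val [::]]big_nil mul1g.
Qed.

Fact free_proj1 : free_proj 1 = 1.
Proof. exact: big_nil. Qed.

Fact free_projV u : free_proj u^-1 = (free_proj u)^-1.
Proof.
apply: (mulgI (free_proj u)); rewrite mulgV -free_projM mulgV.
exact: free_proj1.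
Qed.

Fact free_proj_gen i : free_proj (free_gen i) = gen A i.
Proof. by rewrite /free_proj /word_val big_seq1 /letter_val /= ord_indexK. Qed.

Fact free_proj_surj x : exists u, free_proj u = x.
Proof.
pose H : {pred A} := [pred y : A | `[< exists u, free_proj u = y >] ].
suff /asboolP : x \in H by [].
apply: (@marking_generates n A) => [|i].
  split=> [|_ _ /asboolP[u <-] /asboolP[v <-]]; apply/asboolP.
    by exists 1; exact: free_proj1.
  by exists (u / v); rewrite free_projM free_projV.
by apply/asboolP; exists (free_gen i); exact: free_proj_gen.
Qed.

Fact has_word_ex (x : A) : exists m, has_word x m.
Proof.
have [u <-] := free_proj_surj x.
by exists (size (word_of u)); apply/asboolP; exists (word_of u).
Qed.

Definition word_length (x : A) : nat := ex_minn (has_word_ex x).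

Definition marked_ball (m : nat) : set A := [set x | (word_length x <= m)%N].

Definition growth (m : nat) : nat := #|` fset_set (marked_ball m)|%fset.

Fact marked_ball_finite m : finite_set (marked_ball m).
Proof.
pose f (t : m.-bseq ('I_n * bool)) : A :=
  word_val [seq (ord_index a.1, a.2) | a <- t].
apply: (@sub_finite_set _ _ (f @` setT)); last exact/finite_image/finite_finset.
move=> x; rewrite /marked_ball /word_length /=; case: ex_minnP => k.
move=> /asboolP[s <- <-] _ sm.
have szP : (size [seq (index_ord a.1, a.2) | a <- s] <= m)%N by rewrite size_map.
exists (Bseq szP) => //; rewrite /f /= -map_comp; congr word_val.
by rewrite map_id_in// => -[i b] _ /=; rewrite index_ordK.
Qed.

End WordLength.

Arguments marked_ball {n} A m.

HB.instance Definition _ n := gen_eqMixin (markedGroup n).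
HB.instance Definition _ n := gen_choiceMixin (markedGroup n).

Fact marked_iso_refl n (A : markedGroup n) : marked_iso A A.
Proof. by exists id; split=> //; exists id. Qed.

Fact marked_iso_sym n (A B : markedGroup n) : marked_iso A B -> marked_iso B A.
Proof.
case=> f [fM [g fK gK] fgen]; exists g; split; last 2 first.
- by exists f.
- by move=> i; rewrite -fgen fK.
- by move=> x y; rewrite -[x in LHS]gK -[y in LHS]gK -fM fK.
Qed.

Fact marked_iso_trans n (A B C : markedGroup n) :
  marked_iso A B -> marked_iso B C -> marked_iso A C.
Proof.
case=> f [fM fbij fgen] [g [gM gbij ggen]]; exists (g \o f); split.
- by move=> x y /=; rewrite fM gM.
- exact: bij_comp.
- by move=> i /=; rewrite fgen.
Qed.

Fact marked_kerP n (A : markedGroup n) u v :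
  marked_ker A (u^-1 * v)%g <-> free_proj A u = free_proj A v.
Proof.
rewrite /marked_ker /= free_projM free_projV; split=> [uv|->].
  by rewrite -[RHS](mulVKg (free_proj A u)) uv mulg1.
by rewrite mulVg.
Qed.

Fact marked_morph_word n (A B : markedGroup n) (f : A -> B) :
  {morph f : x y / (x * y)%g} -> (forall i, f (gen A i) = gen B i) ->
  forall s, f (word_val A s) = word_val B s.
Proof.
move=> fM fgen.
have f1 : f 1%g = 1%g by apply: (mulgI (f 1%g)); rewrite -fM !mulg1.
have fV x : f x^-1%g = (f x)^-1%g.
  by apply: (mulgI (f x)); rewrite -fM !mulgV.
elim=> [|[i b] s IHs]; first by rewrite /word_val !big_nil.
rewrite !word_val_cons fM IHs; congr (_ * _)%g.
by case: b; rewrite /letter_val /= ?fV fgen.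
Qed.

Fact marked_ker_iso n (A B : markedGroup n) :
  marked_iso A B <-> marked_ker A = marked_ker B.
Proof.
split=> [[f [fM fbij fgen]]|kerAB].
  have f1 : f 1%g = 1%g by apply: (mulgI (f 1%g)); rewrite -fM !mulg1.
  have fword := marked_morph_word fM fgen.
  apply/seteqP; split=> u; rewrite /marked_ker /free_proj /= -fword.
    by move=> ->.
  by rewrite -f1 => /(bij_inj fbij).
pose lift (C D : markedGroup n) (x : C) : D :=
  free_proj D (projT1 (cid (free_proj_surj x))).
have liftE (C D : markedGroup n) : marked_ker C = marked_ker D ->
    forall u, lift C D (free_proj C u) = free_proj D u.
  move=> kerCD u; rewrite /lift; case: cid => v /= /marked_kerP.
  by rewrite kerCD => /marked_kerP.
exists (lift A B); split.
- move=> x y; have [u <-] := free_proj_surj x; have [v <-] := free_proj_surj y.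
  by rewrite -free_projM !liftE// free_projM.
- exists (lift B A) => x; have [u <-] := free_proj_surj x.
    by rewrite !liftE.
  by rewrite !liftE.
- by move=> i; rewrite -!free_proj_gen liftE.
Qed.

Fact marked_iso_word_length n (A B : markedGroup n) (f : A -> B) :
  {morph f : x y / (x * y)%g} -> injective f ->
  (forall i, f (gen A i) = gen B i) ->
  forall x, word_length (f x) = word_length x.
Proof.
move=> fM finj fgen x.
suff fx : has_word (f x) =1 has_word x.
  by rewrite /word_length; apply: eq_ex_minn => m; rewrite fx.
have fword := marked_morph_word fM fgen.
move=> m; apply/asboolP/asboolP => -[s sm]; last by move=> <-; exists s.
by rewrite -fword => /finj; exists s.
Qed.

Fact marked_iso_growth n (A B : markedGroup n) :
  marked_iso A B -> growth A =1 growth B.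
Proof.
case=> f [fM fbij fgen] m; have lenf := marked_iso_word_length fM (bij_inj fbij) fgen.
have ballE : marked_ball B m = f @` marked_ball A m.
  case: fbij => g fK gK; apply/seteqP; split=> [y By|_ [x Ax <-]].
    by exists (g y); rewrite ?gK// /marked_ball /= -lenf gK.
  by rewrite /marked_ball /= lenf.
rewrite /growth ballE fset_set_image; last exact: marked_ball_finite.
by rewrite card_imfset//; exact: bij_inj.
Qed.

Definition iso_class n (A : markedGroup n) : set (markedGroup n) :=
  [set B | marked_iso A B].

Fact iso_classP n (A B : markedGroup n) :
  iso_class A = iso_class B <-> marked_iso A B.
Proof.
split=> [AB|AB].
  by rewrite -[marked_iso A B]/(iso_class A B) AB; exact: marked_iso_refl.
apply/seteqP; split=> C; apply: marked_iso_trans => //.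
exact: marked_iso_sym.
Qed.

Section MarkedDist.
Variables (R : realType) (n : nat).
Implicit Types A B C : markedGroup n.
Local Open Scope ring_scope.

Definition free_ball (m : nat) : set (freeGroup n) :=
  marked_ball (free_marked n) m.

Definition agree A B : set nat :=
  [set m | free_ball m `&` marked_ker A = free_ball m `&` marked_ker B].

(* The supremum in [\bar R] is the maximum of [agree A B] when this set is
   bounded, and [+oo] when the kernels coincide. *)
Definition agree_radius A B : \bar R :=
  ereal_sup [set m%:R%:E | m in agree A B].

Definition marked_dist A B : R := fine (expeR (- agree_radius A B)).

Fact free_ball_le m m' : (m <= m')%N -> free_ball m `<=` free_ball m'.
Proof. by move=> mm' u /leq_trans; exact. Qed.

Fact agree_le A B m m' : (m <= m')%N -> agree A B m' -> agree A B m.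
Proof.
move=> /free_ball_le mm' AB; rewrite /agree /= -(setIidl mm') -!setIA.
by rewrite -[_ `&` marked_ker A]/(free_ball m' `&` marked_ker A) AB.
Qed.

Fact agree_trans A B C m : agree A B m -> agree B C m -> agree A C m.
Proof. exact: etrans. Qed.

Fact agree0 A B : agree A B 0%N.
Proof.
have ball0 (D : markedGroup n) : free_ball 0 `&` marked_ker D = [set 1%g].
  apply/seteqP; split=> [u [] |_ ->].
    rewrite /free_ball /marked_ball /word_length /=; case: ex_minnP => m.
    move=> /asboolP[s sm su] _; rewrite leqn0 -sm size_eq0 => /eqP s0 _.
    by rewrite -su s0; exact: big_nil.
  split; last exact: free_proj1.
  rewrite /free_ball /marked_ball /word_length /=; case: ex_minnP => m _; apply.
  by apply/asboolP; exists [::] => //; exact: big_nil.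
by rewrite /agree /= !ball0.
Qed.

Fact agree_radius_ge0 A B : (0 <= agree_radius A B)%E.
Proof. by apply: ereal_sup_ubound; exists 0%N => //; exact: agree0. Qed.

Fact agree_radius_sym A B : agree_radius A B = agree_radius B A.
Proof.
congr ereal_sup; congr image; apply/seteqP.
by split=> m; exact: esym.
Qed.

Fact agree_radius_trans A B C :
  (Order.min (agree_radius A B) (agree_radius B C) <= agree_radius A C)%E.
Proof.
rewrite leNgt; apply/negP; rewrite lt_min => /andP[].
move=> /ereal_sup_gt[_ [m1 AB <-] lt1] /ereal_sup_gt[_ [m2 BC <-] lt2].
have : (agree_radius A C < (minn m1 m2)%:R%:E)%E by rewrite /minn; case: ifP.
rewrite ltNge => /negP; apply; apply: ereal_sup_ubound; exists (minn m1 m2) => //.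
apply: agree_trans (agree_le (geq_minl _ _) AB) (agree_le (geq_minr _ _) BC).
Qed.

Fact agree_radius_eqy A B :
  agree_radius A B = +oo%E <-> marked_ker A = marked_ker B.
Proof.
split=> [ABy|kerAB].
  have agreeT m : agree A B m.
    have : (m%:R%:E < agree_radius A B)%E by rewrite ABy ltry.
    move=> /ereal_sup_gt[_ [m' ABm' <-]]; rewrite lte_fin ltr_nat => /ltnW mm'.
    exact: agree_le ABm'.
  apply/seteqP; split=> u keru.
    pose m := word_length (u : free_marked n).
    have : (free_ball m `&` marked_ker A) u by split=> //; exact: leqnn.
    by rewrite agreeT => -[].
  pose m := word_length (u : free_marked n).
  have : (free_ball m `&` marked_ker B) u by split=> //; exact: leqnn.
  by rewrite -agreeT => -[].
apply/eqyP => r r0; apply: (@le_trans _ _ (Num.trunc r).+1%:R%:E).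
  by rewrite lee_fin ltW// truncnS_gt.
by apply: ereal_sup_ubound; exists (Num.trunc r).+1 => //; rewrite /agree /= kerAB.
Qed.

Fact expeR_agree_fin A B : expeR (- agree_radius A B) \is a fin_num.
Proof.
rewrite ge0_fin_numE ?expeR_ge0//; apply: (@le_lt_trans _ _ 1%E); last exact: ltry.
by rewrite -(@expeR0 R) lee_expeR leeNl oppe0 agree_radius_ge0.
Qed.

Fact marked_dist_eq0 A B : marked_dist A B = 0 <-> marked_iso A B.
Proof.
rewrite marked_ker_iso -agree_radius_eqy; split=> [AB0|ABy].
  apply/eqP; rewrite -[agree_radius A B]oppeK eqe_oppLR /= -expeR_eq0.
  by rewrite -[expeR _]fineK ?expeR_agree_fin// -/(marked_dist A B) AB0.
by rewrite /marked_dist ABy /=.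
Qed.

Fact marked_dist_sym A B : marked_dist A B = marked_dist B A.
Proof. by rewrite /marked_dist agree_radius_sym. Qed.

Fact marked_dist_triangle B A C :
  marked_dist A C <= marked_dist A B + marked_dist B C.
Proof.
have dist_ge0 D E : 0 <= marked_dist D E by rewrite fine_ge0 ?expeR_ge0.
have dist_le D E D' E' : (agree_radius D E <= agree_radius D' E')%E ->
    marked_dist D' E' <= marked_dist D E.
  by move=> DE; rewrite fine_le ?expeR_agree_fin// lee_expeR leeN2.
have := agree_radius_trans A B C; rewrite ge_min => /orP[] /dist_le AC.
  by apply: le_trans AC _; rewrite lerDl.
by apply: le_trans AC _; rewrite lerDr.
Qed.

Definition growth_rate_of A : R := limn (fun m => (growth A m)%:R `^ (m%:R^-1)).

End MarkedDist.

(* The set of isomorphism classes. The phantom parameter [R] lets the type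
   determine the field of values of its metric. *)
Definition marked_space (R : realType) (n : nat) : Type :=
  {c : set (markedGroup n) | exists A, c = iso_class A}.

Section MarkedSpace.
Variables (R : realType) (n : nat).
Implicit Types c d : marked_space R n.
Local Open Scope ring_scope.

HB.instance Definition _ := gen_eqMixin (marked_space R n).
HB.instance Definition _ := gen_choiceMixin (marked_space R n).

Definition to_marked_space (A : markedGroup n) : marked_space R n :=
  exist _ (iso_class A) (ex_intro _ A erefl).

Definition marked_repr c : markedGroup n := projT1 (cid (svalP c)).

Fact marked_reprK : cancel marked_repr to_marked_space.
Proof.
move=> [c cP]; apply: eq_exist.
by rewrite /marked_repr; case: cid => /= A <-.
Qed.

Fact to_marked_spaceP A B :
  to_marked_space A = to_marked_space B <-> marked_iso A B.
Proof.
rewrite -iso_classP; split=> [AB|AB]; last exact: eq_exist.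
exact: (congr1 sval AB).
Qed.

Definition space_dist c d : R := marked_dist R (marked_repr c) (marked_repr d).

Fact space_distE A B :
  space_dist (to_marked_space A) (to_marked_space B) = marked_dist R A B.
Proof.
have reprE C : marked_ker (marked_repr (to_marked_space C)) = marked_ker C.
  by apply/marked_ker_iso/to_marked_spaceP; exact: marked_reprK.
by rewrite /space_dist /marked_dist /agree_radius /agree !reprE.
Qed.

Fact space_distxx c : space_dist c c = 0.
Proof. by apply/marked_dist_eq0; exact: marked_iso_refl. Qed.

Fact space_dist_positivity c d : space_dist c d = 0 -> c = d.
Proof.
move=> /marked_dist_eq0/to_marked_spaceP.
by rewrite !marked_reprK.
Qed.

Fact space_dist_sym c d : space_dist c d = space_dist d c.
Proof. exact: marked_dist_sym. Qed.

Fact space_dist_triangle d c e :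
  space_dist c e <= space_dist c d + space_dist d e.
Proof. exact: marked_dist_triangle. Qed.

HB.instance Definition _ := isMetric.Build R (marked_space R n)
  space_distxx space_dist_positivity space_dist_sym space_dist_triangle.

Definition growth_rate c : R := growth_rate_of R (marked_repr c).

Fact growth_rateE A : growth_rate (to_marked_space A) = growth_rate_of R A.
Proof.
rewrite /growth_rate /growth_rate_of; congr (limn _); apply/funext => m.
rewrite (@marked_iso_growth _ _ A)//; apply/to_marked_spaceP.
exact: marked_reprK.
Qed.

End MarkedSpace.

Definition coxeter_matrix n (M : 'M[option nat]_n) : Prop :=
  [/\ (M^T)%R = M, forall i j, M i j <> Some 0%N &
      forall i j, M i j = Some 1%N <-> i = j].

(* [M i j = None] encodes an infinite entry. *)
Definition coxeter_rels n (M : 'M[option nat]_n) : set (freeGroup n) :=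
  [set r | exists (i j : 'I_n) (m : nat),
     [/\ (i <= j)%N, M i j = Some m & r = ((free_gen i * free_gen j) ^+ m)%g]].

Definition coxeter_system n (M : 'M[option nat]_n) : markedGroup n :=
  presented_marked (coxeter_rels M).

Definition coxeter_space (R : realType) (n : nat) : set (marked_space R n) :=
  [set c | exists2 M : 'M[option nat]_n,
     coxeter_matrix M & c = to_marked_space R (coxeter_system M)].
Arguments coxeter_space : clear implicits.

(* Main.v *)
(** Write [W_T(t)] for the growth series of the parabolic subgroup generated by
    [T]. Splitting [W_T] into minimal coset representatives of each [W_U]
    ([U] a subset of [T]) and elements of [W_U] gives the Solomon-Steinberg
    recursion
      [\sum_(U \subset T) (-1)^|U| / W_U(t) = t^N / W_T(t)],
    where [N] is the length of the element of [W_T] having all of [T] as right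
    descents, and the right-hand side is [0] if there is none. Hence [1 / W(t)]
    extends from the disc of convergence to a rational function [F] without poles
    on [[0, 1)], and [F] depends continuously on the marked group, because [N]
    is either locally constant or tends to infinity.

    Upper semicontinuity of the growth rate [omega] is general: [omega] is the
    infimum of the [m]-th roots of the ball sizes (Fekete), which are locally
    constant. For lower semicontinuity, suppose Coxeter systems with
    [omega <= c] converge to one with [omega > c >= 1]. For [1/omega < t < 1/c]
    the approximating values [F(t) = 1 / W(t)] are at most
    [1 / (#ball_m * t^m) <= (omega * t)^-m] with [m] tending to infinity, so the
    limit [F] vanishes on an interval, whereas [F(0) = 1]. *)

Require Import Defs.
From mathcomp Require Import all_boot all_order all_algebra finmap zify lra.
From mathcomp Require Import all_classical all_reals all_analysis.
Set Implicit Arguments.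
Unset Strict Implicit.
Unset Printing Implicit Defensive.
Import Order.TTheory GRing.Theory Num.Theory.
Import numFieldNormedType.Exports.
Local Open Scope classical_set_scope.

(** * The exchange condition and parabolic cosets *)

(** In a Coxeter group, for a reflection [r], the bit [eta x r] tells whether [r] is an inversion of
    [x], that is, whether [x * r] is shorter than [x]. The existence of such an [eta] is the form in
    which the Coxeter relations enter all later arguments on lengths, cosets and limits. *)
Record reflection_cocycle n (A : markedGroup n) (eta : A -> A -> bool) : Prop := {
  gen_involutive : forall i, (gen A i * gen A i = 1)%g;
  cocycle_gen : forall i r, eta (gen A i) r = (r == gen A i);
  cocycleM : forall x y r, eta (x * y)%g r = eta y r (+) eta x (r ^ y^-1)%g }.

Section Words.
Variables (n : nat) (A : markedGroup n).
Local Open Scope group_scope.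

Definition gen_prod (s : seq 'I_n) : A := \prod_(i <- s) gen A i.

Lemma gen_prod_cons i s : gen_prod (i :: s) = gen A i * gen_prod s.
Proof. exact: big_cons. Qed.

Lemma gen_prod_cat s t : gen_prod (s ++ t) = gen_prod s * gen_prod t.
Proof. exact: big_cat. Qed.

Lemma gen_prod_rcons s i : gen_prod (rcons s i) = gen_prod s * gen A i.
Proof. by rewrite -cats1 gen_prod_cat /gen_prod big_seq1. Qed.

Lemma word_val_cat s t : word_val A (s ++ t) = word_val A s * word_val A t.
Proof. exact: big_cat. Qed.

Lemma word_length_le (s : seq (letter n)) : word_length (word_val A s) <= size s.
Proof.
rewrite /word_length; case: ex_minnP => m _; apply.
by apply/asboolP; exists s.
Qed.

Lemma word_length_ex (x : A) :
  exists2 s : seq (letter n), size s = word_length x & word_val A s = x.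
Proof. by rewrite /word_length; case: ex_minnP => m /asboolP. Qed.

Lemma word_length_mul (x y : A) :
  word_length (x * y) <= word_length x + word_length y.
Proof.
have [s <- <-] := word_length_ex x; have [t <- <-] := word_length_ex y.
by rewrite -word_val_cat -size_cat word_length_le.
Qed.

Lemma word_length1 : word_length (1 : A) = 0%N.
Proof. by have := word_length_le [::]; rewrite /word_val big_nil leqn0 => /eqP. Qed.

Lemma word_length_eq0 (x : A) : word_length x = 0%N -> x = 1.
Proof.
by have [s <- <-] := word_length_ex x => /size0nil ->; exact: big_nil.
Qed.

Lemma gen_prodE s : gen_prod s = word_val A [seq (ord_index i, false) | i <- s].
Proof.
rewrite /word_val big_map; apply: eq_bigr => i _.
by rewrite /letter_val /= ord_indexK.
Qed.

Lemma gen_prod_length s : word_length (gen_prod s) <= size s.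
Proof. by rewrite gen_prodE (leq_trans (word_length_le _)) ?size_map. Qed.

Lemma gen_length i : word_length (gen A i) <= 1.
Proof. by have := gen_prod_length [:: i]; rewrite /gen_prod big_seq1. Qed.

Definition parabolic (T : {set 'I_n}) : set A :=
  [set w | exists2 s : seq 'I_n, {subset s <= T} & gen_prod s = w].

Definition descent (w : A) i := word_length (w * gen A i) < word_length w.

Definition min_coset_rep (T U : {set 'I_n}) : set A :=
  [set w | parabolic T w /\ forall i, i \in U -> ~~ descent w i].

(** In a Coxeter group this set consists of the longest element of the parabolic subgroup when that
    subgroup is finite, and is empty otherwise. *)
Definition full_descent (T : {set 'I_n}) : set A :=
  [set w | parabolic T w /\ forall i, i \in T -> descent w i].

Lemma parabolic1 T : parabolic T 1.
Proof. by exists [::] => //; rewrite /gen_prod big_nil. Qed.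

Lemma parabolic_gen (T : {set 'I_n}) i : i \in T -> parabolic T (gen A i).
Proof.
move=> iT; exists [:: i]; last by rewrite /gen_prod big_seq1.
by move=> j; rewrite inE => /eqP ->.
Qed.

Lemma parabolicM T x y : parabolic T x -> parabolic T y -> parabolic T (x * y).
Proof.
move=> [s sT <-] [t tT <-]; exists (s ++ t); last exact: gen_prod_cat.
by move=> i; rewrite mem_cat => /orP[/sT|/tT].
Qed.

Lemma parabolicS (T U : {set 'I_n}) : U \subset T -> parabolic U `<=` parabolic T.
Proof.
by move=> /fintype.subsetP UT w [s sU <-]; exists s => // i /sU /UT.
Qed.

End Words.

Arguments parabolic {n} A T.
Arguments min_coset_rep {n} A T U.
Arguments full_descent {n} A T.

Section CoxeterGeometry.
Variables (n : nat) (A : markedGroup n) (eta : A -> A -> bool).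
Hypothesis etaP : reflection_cocycle eta.
Local Open Scope group_scope.
Local Notation l := (@word_length n A).
Local Notation s_ := (gen A).
Implicit Types (T U : {set 'I_n}) (w x y u v r : A) (i j : 'I_n).

Let gen2 i : s_ i * s_ i = 1. Proof. exact: gen_involutive etaP i. Qed.

Lemma genV i : (s_ i)^-1 = s_ i.
Proof. by apply: (mulgI (s_ i)); rewrite mulgV gen2. Qed.

Lemma gen_prodV s : (gen_prod A s)^-1 = gen_prod A (rev s).
Proof.
elim: s => [|i s IHs]; first by rewrite /gen_prod !big_nil invg1.
by rewrite gen_prod_cons rev_cons gen_prod_rcons invgM genV IHs.
Qed.

Lemma word_val_gen_prod (s : seq (letter n)) :
  word_val A s = gen_prod A [seq index_ord a.1 | a <- s].
Proof.
rewrite /gen_prod big_map; apply: eq_bigr => a _.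
by rewrite /letter_val genV if_same.
Qed.

Lemma gen_prod_ex x : exists2 s : seq 'I_n, size s = l x & gen_prod A s = x.
Proof.
have [s sl sx] := word_length_ex x.
exists [seq index_ord a.1 | a <- s]; first by rewrite size_map.
by rewrite -word_val_gen_prod.
Qed.

Lemma word_lengthV x : l x^-1 = l x.
Proof.
suff le y : l y^-1 <= l y by apply/eqP; rewrite eqn_leq le -{1}[x]invgK le.
have [s <- <-] := gen_prod_ex y.
by rewrite gen_prodV -(size_rev s) gen_prod_length.
Qed.

Lemma mulg_genK x i : x * s_ i * s_ i = x.
Proof. by rewrite -mulgA gen2 mulg1. Qed.

Lemma eta1 r : eta 1 r = false.
Proof.
have := cocycleM etaP 1 1 r; rewrite mulg1 invg1 conjg1.
by case: (eta 1 r).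
Qed.

(* Strong exchange: [eta x r] counts modulo 2 the letters of a word for [x]
   whose deletion gives a word for [x * r]. *)
Lemma eta_deletion s r : eta (gen_prod A s) r ->
  exists s' : seq 'I_n, [/\ (size s' < size s)%N, {subset s' <= s} &
    gen_prod A s' = gen_prod A s * r].
Proof.
elim: s => [|i s IHs]; first by rewrite /gen_prod big_nil eta1.
rewrite gen_prod_cons (cocycleM etaP) (cocycle_gen etaP).
case sr: (eta _ r).
  move=> _; have [s' [sz sub s'E]] := IHs sr; exists (i :: s'); split => //=.
    by move=> j; rewrite !inE => /orP[->//|/sub ->]; rewrite orbT.
  by rewrite !gen_prod_cons s'E !mulgA.
rewrite addFb => /eqP rE.
exists s; split => //=; first by move=> j; rewrite inE => ->; rewrite orbT.
have -> : r = s_ i ^ gen_prod A s by rewrite -rE conjgKV.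
by rewrite conjgE -mulgA mulVKg mulgA gen2 mul1g.
Qed.

Lemma eta_length x r : eta x r -> l (x * r) < l x.
Proof.
have [s <- <-] := gen_prod_ex x.
move=> /eta_deletion[s' [sz _ <-]].
exact: leq_ltn_trans (gen_prod_length _ _) sz.
Qed.

Local Notation descent := (@descent n A).
Local Notation parabolic := (@parabolic n A).

(** By the cocycle rule, [eta w (s_ i)] flips when [w] is multiplied by [s_ i]; hence strong
    exchange shortens exactly one of [w] and [w * s_ i]. *)
Lemma descentE w i : descent w i = eta w (s_ i).
Proof.
apply/idP/idP; last exact: eta_length.
apply: contraTT => ws; rewrite /descent -leqNgt ltnW//.
rewrite -{1}[w](mulg_genK _ i); apply: eta_length.
by rewrite (cocycleM etaP) (cocycle_gen etaP) eqxx genV /conjg genV gen2 mulg1.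
Qed.

Lemma length_descent w i : descent w i -> l w = (l (w * s_ i)).+1.
Proof.
rewrite /descent => lt; apply/eqP; rewrite eqn_leq lt andbT.
rewrite -{1}[w](mulg_genK _ i) (leq_trans (word_length_mul _ _))//.
by rewrite -addn1 leq_add2l gen_length.
Qed.

Lemma length_ascent w i : ~~ descent w i -> l (w * s_ i) = (l w).+1.
Proof.
move=> asc; rewrite (@length_descent _ i) ?mulg_genK//.
move: asc; rewrite !descentE (cocycleM etaP) (cocycle_gen etaP) eqxx.
by rewrite genV /conjg genV gen2 mulg1 => /negPf ->.
Qed.
Lemma parabolicV T x : parabolic T x -> parabolic T x^-1.
Proof.
move=> [s sT <-]; exists (rev s); last by rewrite gen_prodV.
by move=> i; rewrite mem_rev => /sT.
Qed.

Lemma parabolic_conj T x y : parabolic T x -> parabolic T y -> parabolic T (x ^ y).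
Proof.
by move=> Tx Ty; apply: parabolicM; [exact: parabolicV|exact: parabolicM].
Qed.

(** Build the word letter by letter. When a new letter is a descent, exchange deletes a letter
    instead of adding one, so the word never leaves [T]. *)
Lemma parabolic_reduced T w : parabolic T w ->
  exists s : seq 'I_n, [/\ {subset s <= T}, size s = l w & gen_prod A s = w].
Proof.
case=> s sT <-; elim/last_ind: s => [|s i IHs] in sT *.
  by exists [::]; split=> //; rewrite /gen_prod big_nil word_length1.
have [|t [tT tl tE]] := IHs.
  by move=> j js; apply: sT; rewrite mem_rcons inE js orbT.
have iT : i \in T by apply: sT; rewrite mem_rcons inE eqxx.
rewrite gen_prod_rcons -tE in tl *; case: (boolP (descent (gen_prod A t) i)) => di.
  have [u [ut uT uE]] : exists s' : seq 'I_n, [/\ (size s' < size t)%N, {subset s' <= t} &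
    gen_prod A s' = gen_prod A t * s_ i].
    by apply: eta_deletion; rewrite -descentE.
  exists u; split=> //; first by move=> j /uT /tT.
  have := length_descent di; have := gen_prod_length A u; rewrite -uE; lia.
exists (rcons t i); split; last by rewrite gen_prod_rcons.
  by move=> j; rewrite mem_rcons inE => /orP[/eqP->|/tT].
by rewrite size_rcons tl length_ascent.
Qed.

Definition reduced_gen_word s := size s == l (gen_prod A s).

Lemma reduced_gen_word_cat s t : reduced_gen_word (s ++ t) ->
  reduced_gen_word s && reduced_gen_word t.
Proof.
rewrite /reduced_gen_word gen_prod_cat size_cat.
have := word_length_mul (gen_prod A s) (gen_prod A t).
have := gen_prod_length A s; have := gen_prod_length A t.
move=> lt ls lst /eqP st; apply/andP; split; apply/eqP; lia.
Qed.

(** Append the letters of a reduced word of [v] one at a time. By the cocycle rule a letter [i]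
    after the prefix [s] could be a descent only through [eta u] at a conjugate of [s_ i] by an
    element of the parabolic subgroup of [U], and [eta u] vanishes there. *)
Lemma length_coset_eta U u v : (forall r, parabolic U r -> ~~ eta u r) ->
  parabolic U v -> l (u * v) = (l u + l v)%N.
Proof.
move=> minu /parabolic_reduced[s [sU red sE]]; rewrite -{v}sE in red *.
move/eqP: red; rewrite -/(reduced_gen_word s).
elim/last_ind: s => [|s i IHs] in sU *.
  by rewrite /gen_prod big_nil mulg1 word_length1 addn0.
have sU' : {subset s <= U} by move=> j js; apply: sU; rewrite mem_rcons inE js orbT.
have iU : i \in U by apply: sU; rewrite mem_rcons inE eqxx.
move=> red; have : reduced_gen_word (s ++ [:: i]) by rewrite cats1.
move=> /reduced_gen_word_cat/andP[reds _].
have {}IHs := IHs sU' reds.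
have up : ~~ descent (gen_prod A s) i.
  by rewrite /descent -gen_prod_rcons -(eqP red) -(eqP reds) size_rcons -leqNgt.
rewrite gen_prod_rcons mulgA !length_ascent//; first by rewrite IHs addnS.
rewrite descentE (cocycleM etaP) -descentE (negPf up).
by apply/minu/parabolic_conj; [exact: parabolic_gen|apply: parabolicV; exists s].
Qed.

(** Take an element of least length in the left coset of [w]: by strong exchange, [eta] true at some
    [r] of the subgroup would give a shorter one. *)
Lemma min_coset_ex U w : exists u v,
  [/\ parabolic U v, w = u * v & forall r, parabolic U r -> ~~ eta u r].
Proof.
pose P : pred nat := [pred m | `[< exists2 v, parabolic U v & l (w * v) = m >] ].
have exP : exists m, P m.
  by exists (l (w * 1)); apply/asboolP; exists 1 => //; exact: parabolic1.
have [m /asboolP[v Uv vm] minm] := ex_minnP exP.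
exists (w * v), v^-1; split; [exact: parabolicV|by rewrite mulgK|].
move=> r Ur; apply/negP => /eta_length; rewrite vm -mulgA ltnNge => /negP; apply.
by apply: minm; apply/asboolP; exists (v * r) => //; exact: parabolicM.
Qed.

(** Passes from the generators in [U] to the whole subgroup. Write [u = u0 * v] with [u0] minimal in
    its coset; lengths add, so the last letter of a nontrivial [v] would be a descent of [u]. *)
Lemma ascent_coset_eta U u : (forall i, i \in U -> ~~ descent u i) ->
  forall r, parabolic U r -> ~~ eta u r.
Proof.
move=> asc; have [u0 [v [Uv uE minu0]]] := min_coset_ex U u.
have [s [sU sl sE]] := parabolic_reduced Uv.
case: (lastP s) => [|t i] in sU sl sE.
  suff -> : u = u0 by [].
  by rewrite uE -sE /gen_prod big_nil mulg1.
have iU : i \in U by apply: sU; rewrite mem_rcons inE eqxx.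
have Ut : parabolic U (gen_prod A t).
  by exists t => // j jt; apply: sU; rewrite mem_rcons inE jt orbT.
have := asc i iU; rewrite /descent uE (length_coset_eta minu0 Uv) -mulgA.
have vi : v * s_ i = gen_prod A t by rewrite -sE gen_prod_rcons mulg_genK.
rewrite vi (length_coset_eta minu0 Ut) ltn_add2l -sl size_rcons ltnS.
by rewrite gen_prod_length.
Qed.

Lemma length_coset U u v : (forall i, i \in U -> ~~ descent u i) ->
  parabolic U v -> l (u * v) = (l u + l v)%N.
Proof. by move=> /ascent_coset_eta; exact: length_coset_eta. Qed.

(** The two representatives differ by an element of the subgroup; lengths add in both directions, so
    that element has length zero. *)
Lemma coset_rep_unique U u u' v v' :
  (forall i, i \in U -> ~~ descent u i) ->
  (forall i, i \in U -> ~~ descent u' i) ->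
  parabolic U v -> parabolic U v' -> u * v = u' * v' -> u = u'.
Proof.
move=> ascu ascu' Uv Uv' uv.
have Uvv : parabolic U (v * v'^-1) by apply/parabolicM/parabolicV.
have u'E : u' = u * (v * v'^-1) by rewrite mulgA uv mulgK.
have uE : u = u' * (v * v'^-1)^-1 by rewrite u'E mulgK.
have := length_coset ascu Uvv; rewrite -u'E.
have := length_coset ascu' (parabolicV Uvv); rewrite -uE => -> /eqP.
rewrite -addnA -[X in X == _]addn0 eqn_add2l eq_sym addn_eq0.
by move=> /andP[_ /eqP/word_length_eq0 vv1]; rewrite u'E vv1 mulg1.
Qed.

Lemma min_coset_rep_bij T U : U \subset T ->
  set_bij (min_coset_rep A T U `*` parabolic U) (parabolic T)
    (fun p : A * A => p.1 * p.2).
Proof.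
move=> UT; split.
- by move=> [u v] [[/= Tu _] /(parabolicS UT)]; exact: parabolicM.
- move=> [u v] [u' v'] /set_mem[[/= _ ascu] Uv] /set_mem[[/= _ ascu'] Uv'] uv.
  have uu' := coset_rep_unique ascu ascu' Uv Uv' uv.
  by congr pair => //; apply: (mulgI u); rewrite uv uu'.
- move=> w Tw; have [u [v [Uv wE minu]]] := min_coset_ex U w.
  exists (u, v) => //; split=> //=; split.
    have -> : u = w * v^-1 by rewrite wE mulgK.
    by apply: parabolicM => //; apply/parabolicV/(parabolicS UT).
  by move=> i iU; rewrite descentE; apply/minu/parabolic_gen.
Qed.

Lemma min_coset_repTT T : min_coset_rep A T T = [set 1].
Proof.
apply/seteqP; split=> [u [Tu ascu]|_ ->].
  apply: (@coset_rep_unique T _ 1 1 u) => //; first last.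
  - by rewrite mulg1 mul1g.
  - exact: parabolic1.
  - by move=> i _; rewrite /descent word_length1.
by split=> [|i _]; [exact: parabolic1|rewrite /descent word_length1].
Qed.

(** Converse of [eta_length] for reflections: since [eta r r] holds, [eta x r] flips when [x] is
    replaced by [x * r]. *)
Lemma eta_reflection x i b : l (x * s_ i ^ b) < l x -> eta x (s_ i ^ b).
Proof.
set r := s_ i ^ b => lt.
have rr : r * r = 1 by rewrite -conjMg gen2 conj1g.
have eta_r : eta r r.
  have rb : r ^ b^-1 = s_ i by rewrite conjgK.
  (* The contributions of [b] and of its inverse to [eta r r] cancel, which leaves that of the
     middle letter [s_ i]. *)
  have bb : eta b r (+) eta b^-1 (s_ i) = false.
    by rewrite -rb -(cocycleM etaP) mulVg eta1.
  suff : eta (b^-1 * (s_ i * b)) r by rewrite -conjgE -/r.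
  rewrite !(cocycleM etaP) rb.
  have -> : r ^ (s_ i * b)^-1 = s_ i by rewrite invgM conjgM rb /conjg !genV gen2 mulg1.
  by rewrite (cocycle_gen etaP) eqxx; move: bb; case: (eta b r); case: (eta b^-1 _).
apply: contraTT lt => etax; rewrite -leqNgt ltnW//.
rewrite -{1}[x]mulg1 -rr mulgA; apply: eta_length.
by rewrite (cocycleM etaP) eta_r /conjg invgK mulgV mulg1 addTb.
Qed.

(** Multiplying [w] by any reduced word in [T] shortens it at every letter, so [w] is a longest
    element. The induction treats a word as [i], [c], [j] and applies the hypothesis to [c], to [i]
    followed by [c], and to [c] followed by [j]. *)
Lemma full_descent_length T w (s : seq 'I_n) : full_descent A T w ->
  {subset s <= T} -> reduced_gen_word s -> (l (w * gen_prod A s) + size s)%N = l w.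
Proof.
move=> [_ descw]; have [k] := ubnP (size s); elim: k s => // k IHk [|i s'].
  by rewrite /gen_prod big_nil mulg1 addn0.
case: (lastP s') => [|c j].
  move=> _ sT _; have iT : i \in T by apply: sT; rewrite inE.
  by rewrite /gen_prod big_seq1 addn1 -length_descent//; exact: descw.
move=> sk sT red; have iT : i \in T by apply: sT; rewrite inE eqxx.
have jT : j \in T by apply: sT; rewrite inE mem_rcons inE eqxx orbT.
have cT : {subset c <= T} by move=> h hc; apply: sT; rewrite inE mem_rcons inE hc !orbT.
have redic : reduced_gen_word (i :: c).
  by move: red; rewrite -rcons_cons -cats1 => /reduced_gen_word_cat/andP[].
have redcj : reduced_gen_word (rcons c j).
  by move: red; rewrite -cat1s => /reduced_gen_word_cat/andP[].
have redc : reduced_gen_word c.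
  by move: redcj; rewrite -cats1 => /reduced_gen_word_cat/andP[].
move: sk; rewrite /= size_rcons ltnS => sk.
have lc : (l (w * gen_prod A c) + size c)%N = l w by apply: IHk => //; exact: ltnW.
have lic : (l (w * gen_prod A (i :: c)) + (size c).+1)%N = l w.
  by apply: (IHk (i :: c)) => //= h; rewrite inE => /orP[/eqP->//|/cT].
have lcj : (l (w * gen_prod A (rcons c j)) + (size c).+1)%N = l w.
  rewrite -(size_rcons c j); apply: IHk; rewrite ?size_rcons// => h.
  by rewrite mem_rcons inE => /orP[/eqP->//|/cT//].
rewrite -rcons_cons gen_prod_rcons mulgA.
suff /length_descent : descent (w * gen_prod A (i :: c)) j.
  by move=> dE; rewrite -lic dE addSnnS.
(* If [j] is an ascent, [r] is an inversion of [y]. Moving it past [s_ j] either gives [r = s_ j],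
   so that [i], [c], [j] is not reduced, or makes [y * r * s_ j] shorter than [y * s_ j], against
   the known lengths. *)
apply: contraT => /length_ascent asc.
set y := w * gen_prod A c in lc.
set r := s_ i ^ gen_prod A c.
have yr : y * r = w * gen_prod A (i :: c).
  by rewrite /y /r conjgE !mulgA mulgK gen_prod_cons mulgA.
have : eta y r by apply: eta_reflection; rewrite -/r yr; lia.
rewrite -{1}[y](mulg_genK _ j) (cocycleM etaP) (cocycle_gen etaP) genV.
case: eqP => [rj _|_ /= /eta_length].
  move: red; rewrite /reduced_gen_word /= size_rcons gen_prod_cons gen_prod_rcons.
  have -> : s_ i * (gen_prod A c * s_ j) = gen_prod A c.
    by rewrite -rj /r conjgE mulVKg mulgA gen2 mul1g.
  by have := gen_prod_length A c; lia.
have -> : y * s_ j * (r ^ s_ j) = y * r * s_ j.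
  by rewrite conjgE genV !mulgA mulg_genK.
have -> : y * s_ j = w * gen_prod A (rcons c j) by rewrite gen_prod_rcons mulgA.
by rewrite yr asc; lia.
Qed.

(** With [v = w^-1 * w'], both [l w' = l w - l v] and [l w = l w' - l v] hold, so [v] is trivial. *)
Lemma full_descent_unique T w w' : full_descent A T w -> full_descent A T w' -> w = w'.
Proof.
move=> Dw Dw'; have [[Tw _] [Tw' _]] := (Dw, Dw').
have Tv : parabolic T (w^-1 * w') by apply: parabolicM => //; exact: parabolicV.
have [s [sT sl sE]] := parabolic_reduced Tv.
have [s' [s'T s'l s'E]] := parabolic_reduced (parabolicV Tv).
have := full_descent_length Dw sT; have := full_descent_length Dw' s'T.
rewrite /reduced_gen_word sE s'E sl s'l !eqxx => /(_ isT) + /(_ isT).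
rewrite word_lengthV.
have -> : w' / (w^-1 * w') = w by rewrite invgM invgK mulVKg.
rewrite mulVKg => {1}<- /eqP; rewrite -addnA -[X in _ == X]addn0 eqn_add2l.
rewrite addn_eq0 => /andP[/eqP/word_length_eq0 vv _].
by rewrite -[w]mulg1 -vv mulVKg.
Qed.
End CoxeterGeometry.

(** * The reflection cocycle of a Coxeter group *)

Lemma free_proj_word n (A : markedGroup n) s :
  free_proj A (word_val (free_marked n) s) = word_val A s.
Proof.
apply: (@marked_morph_word n (free_marked n) A (free_proj A)).
  exact: free_projM.
exact: free_proj_gen.
Qed.

Section CoxeterCocycle.
Variables (n : nat) (M : 'M[option nat]_n).
Hypothesis coxM : coxeter_matrix M.
Local Open Scope group_scope.
Local Notation A := (coxeter_system M).
Local Notation s_ := (gen A).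

Lemma coxeter_pi (u : freeGroup n) :
  (pres_pi (coxeter_rels M) u : A) = free_proj A u.
Proof.
have [s _ <-] := word_length_ex (u : free_marked n).
rewrite free_proj_word.
apply: (@marked_morph_word n (free_marked n) A (pres_pi _ : free_marked n -> A)) => //.
exact: pres_piM.
Qed.

Lemma coxeter_rel (i j : 'I_n) m : (i <= j)%N -> M i j = Some m -> (s_ i * s_ j) ^+ m = 1.
Proof.
move=> ij Mij.
have relX u k : free_proj A (u ^+ k) = free_proj A u ^+ k.
  elim: k => [|k IHk]; first by rewrite !expg0 free_proj1.
  by rewrite !expgS free_projM IHk.
rewrite -!free_proj_gen -free_projM -relX -(free_proj1 A) -!coxeter_pi.
apply/pres_piP => N Ngrp Nconj Nrels; rewrite mulg1.
by apply: (group_closedV Ngrp); apply: Nrels; exists i, j, m.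
Qed.

Lemma coxeter_gen2 i : s_ i * s_ i = 1.
Proof.
have [_ _ /(_ i i)[_ Mii]] := coxM.
exact: (coxeter_rel (leqnn i) (Mii erefl)).
Qed.

(** The classical signed action on reflections, extended to all group elements: conjugate, and flip
    the sign when the element is the acting generator itself. *)
Definition letter_act (a : letter n) (p : A * bool) : A * bool :=
  (p.1 ^ (letter_val A a)^-1, p.2 (+) (p.1 == s_ (index_ord a.1))).

Definition free_act (u : freeGroup n) (p : A * bool) : A * bool :=
  foldr letter_act p (word_of u).

Lemma letter_valE a : letter_val A a = s_ (index_ord a.1).
Proof.
rewrite /letter_val; case: ifP => // _; apply: (mulgI (s_ (index_ord a.1))).
by rewrite mulgV coxeter_gen2.
Qed.

(** Makes the cancellations performed by [push] invisible, so that words act through the free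
    group. *)
Lemma letter_actK a p : letter_act a (letter_act (inv_letter a) p) = p.
Proof.
case: p => r e; rewrite /letter_act !letter_valE /= -conjgM -invgM.
rewrite coxeter_gen2 invg1 conjg1 -addbA; congr (_, _).
rewrite (can2_eq (conjgKV _) (conjgK _)) conjgE mulKg.
by rewrite addbb addbF.
Qed.

Lemma free_actM u v p : free_act (u * v) p = free_act u (free_act v p).
Proof.
rewrite /free_act /=; elim: (word_of u) => //= a s <-.
case: word_mul => //= b t; case: eqP => //= ->.
by rewrite letter_actK.
Qed.

Lemma free_act_parity u r e :
  free_act u (r, e) = (r ^ (free_proj A u)^-1, e (+) (free_act u (r, false)).2).
Proof.
rewrite /free_act /free_proj; elim: (word_of u) e => [|a s IHs] e /=.
  by rewrite /word_val big_nil invg1 conjg1 addbF.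
rewrite (IHs e) (IHs false) /letter_act /= word_val_cons invgM conjgM.
by rewrite addbA.
Qed.

(** Conjugation by [s_ j] inverts [s_ i * s_ j]. Hence the elements whose sign is flipped along a
    power of [s_ i * s_ j] have the form [s_ j * (s_ i * s_ j) ^+ q], with [q] even for the letter
    [j] and odd for the letter [i]. *)
Lemma dihedral_reflection i j k r :
  (r ^ ((s_ i * s_ j) ^+ k)^-1 == s_ j) = (r == s_ j * (s_ i * s_ j) ^+ (k + k)) /\
  ((r ^ ((s_ i * s_ j) ^+ k)^-1) ^ (s_ j)^-1 == s_ i)
    = (r == s_ j * (s_ i * s_ j) ^+ (k + k).+1).
Proof.
set h := s_ i * s_ j.
have sV a : (s_ a)^-1 = s_ a.
  by apply: (mulgI (s_ a)); rewrite mulgV coxeter_gen2.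
have hj : h ^ s_ j = h^-1 by rewrite conjgE /h invgM !sV -(mulgA (s_ i)) coxeter_gen2 mulg1.
have jh : s_ j ^ h ^+ k = s_ j * h ^+ (k + k).
  rewrite conjgE expgnDr -expVgn -hj -conjXg conjgE sV -!mulgA.
  by rewrite (mulgA (s_ j) (s_ j)) coxeter_gen2 mul1g.
split; first by rewrite (can2_eq (conjgKV _) (conjgK _)) jh.
rewrite -conjgM -invgM (can2_eq (conjgKV _) (conjgK _)) conjgM.
have -> : s_ i ^ s_ j = s_ j * h by rewrite conjgE sV.
rewrite conjMg jh conjgE. rewrite (commuteX k (commute_refl h)). by rewrite mulKg -mulgA -expgSr.
Qed.

(** A relator with exponent [m] flips the sign once for each [q < m + m] with [t = s_ j * h ^+ q].
    As [h ^+ m = 1], the terms [q] and [m + q] cancel. *)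
Lemma free_act_rel r : coxeter_rels M r -> free_act r = id.
Proof.
move=> [i [j [m [ij Mij ->]]]]; apply/funext => -[t e].
set h := s_ i * s_ j; have hm : h ^+ m = 1 by exact: coxeter_rel.
have actX k : free_act ((free_gen i * free_gen j) ^+ k) (t, e) =
    (t ^ (h ^+ k)^-1, e (+) \big[addb/false]_(q < k + k) (t == s_ j * h ^+ q)).
  elim: k => [|k IHk].
    by rewrite !expg0 big_ord0 invg1 conjg1 addbF.
  rewrite expgS !free_actM IHk /free_act /= /letter_act !letter_valE /= !ord_indexK.
  have [-> ->] := dihedral_reflection i j k t.
  rewrite -!conjgM -!invgM -/h -expgS addnS addSn !big_ord_recr /=.
  by rewrite !addbA.
rewrite actX hm invg1 conjg1 big_split_ord /=.
rewrite [X in _ (+) (_ (+) X)](eq_bigr (fun q : 'I_m => t == s_ j * h ^+ q)).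
  by rewrite addbb addbF.
by move=> q _; rewrite expgnDr hm mul1g.
Qed.

Lemma free_act_wd u v : pres_pi (coxeter_rels M) u = pres_pi (coxeter_rels M) v ->
  free_act u = free_act v.
Proof.
move=> /pres_piP uv.
(* The elements that act trivially form a normal subgroup containing the relators, hence their
   normal closure. *)
pose N : {pred freeGroup n} := [pred x | `[< forall p, free_act x p = p >] ].
suff /asboolP uv1 : (u^-1 * v)%g \in N.
  by apply/funext => p; rewrite -[v](mulVKg u) free_actM uv1.
apply: uv => [|y z /asboolP y1|r rr]; last first.
- by apply/asboolP => p; rewrite free_act_rel.
- by apply/asboolP => p; rewrite !free_actM y1 -free_actM mulVg.
split; first exact/asboolP.
move=> x y /asboolP x1 /asboolP y1; apply/asboolP => p.
by rewrite free_actM x1 -{1}[p]y1 -free_actM mulVg.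
Qed.

Definition coxeter_eta (x r : A) : bool := (free_act (pres_repr x) (r, false)).2.

Lemma coxeter_etaE u r :
  coxeter_eta (pres_pi (coxeter_rels M) u) r = (free_act u (r, false)).2.
Proof. by rewrite /coxeter_eta (free_act_wd (pres_reprK (pres_pi _ u))). Qed.

Lemma coxeter_cocycle : reflection_cocycle coxeter_eta.
Proof.
split=> [|i r|x y r]; first exact: coxeter_gen2.
  rewrite -[s_ i]/(pres_pi _ (free_gen i)) coxeter_etaE /=.
  by rewrite ord_indexK.
rewrite -[x]pres_reprK -[y]pres_reprK; move: (pres_repr x) (pres_repr y) => u v.
rewrite -[_ * _]/(pres_mul _ _) -pres_piM !coxeter_etaE free_actM.
case actv: (free_act v (r, false)) => [r' e].
have := free_act_parity v r false; rewrite actv => -[->] /=.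
by rewrite free_act_parity /= coxeter_pi.
Qed.

End CoxeterCocycle.

(** * Marked groups that agree on a ball *)

Section Transfer.
Variable n : nat.
Implicit Types (A B : markedGroup n) (s t : seq (letter n)).
Local Open Scope group_scope.

Lemma word_val_inv A s : word_val A (word_inv s) = (word_val A s)^-1.
Proof.
elim: s => [|a s IHs]; first by rewrite /word_val !big_nil invg1.
rewrite /word_inv /= rev_cons -cats1 word_val_cat -/(word_inv s) IHs.
rewrite [in RHS]word_val_cons invgM.
suff -> : word_val A [:: inv_letter a] = (letter_val A a)^-1 by [].
rewrite /word_val big_seq1 /letter_val /=.
by case: a.2 => /=; rewrite ?invgK.
Qed.

(** An equality of two words is a relator of length at most the sum of their lengths; this is the
    source of the doubled radii in the transfer lemmas. *)
Lemma agree_word A B m s t : agree A B m -> (size s + size t <= m)%N ->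
  word_val A s = word_val A t -> word_val B s = word_val B t.
Proof.
move=> AB st; rewrite -(free_proj_word A s) -(free_proj_word A t).
rewrite -(free_proj_word B s) -(free_proj_word B t) => /marked_kerP kerA.
apply/marked_kerP.
set u := _^-1 * _ in kerA *.
suff : (free_ball m `&` marked_ker A) u by rewrite AB => -[].
split=> //; have -> : u = word_val (free_marked n) (word_inv s ++ t).
  by rewrite word_val_cat word_val_inv.
rewrite /free_ball /marked_ball /= (leq_trans (word_length_le _ _))//.
by rewrite size_cat /word_inv size_rev size_map.
Qed.

Lemma agree_sym A B m : agree A B m -> agree B A m.
Proof. exact: esym. Qed.

Lemma agree_word_length A B m s : agree A B m -> (size s + size s <= m)%N ->
  word_length (word_val A s) = word_length (word_val B s).
Proof.
suff le C D : agree C D m -> (size s + size s <= m)%N ->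
    (word_length (word_val D s) <= word_length (word_val C s))%N.
  by move=> AB sm; apply/eqP; rewrite eqn_leq (le A B)// (le B A)//.
move=> CD sm; have [t tl tE] := word_length_ex (word_val C s).
have ts : (size t <= size s)%N by rewrite tl word_length_le.
rewrite -tl -(agree_word CD _ tE) ?word_length_le//.
exact: leq_trans (leq_add ts (leqnn _)) sm.
Qed.

Lemma mem_marked_ball A m x : (x \in fset_set (marked_ball A m)) = (word_length x <= m)%N.
Proof.
rewrite in_fset_set; last exact: marked_ball_finite.
by apply/idP/idP => [/set_mem//|xm]; exact/mem_set.
Qed.

Lemma agree_growth A B m k : agree A B m -> (k + k <= m)%N -> growth A k = growth B k.
Proof.
suff le (C D : markedGroup n) : agree C D m -> (k + k <= m)%N -> (growth C k <= growth D k)%N.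
  by move=> AB km; apply/eqP; rewrite eqn_leq  (le A B)// (le B A)//.
move=> CD km.
pose f (x : C) : D := word_val D (projT1 (cid2 (word_length_ex x))).
have -> : growth C k = #|` [fset f x | x in fset_set (marked_ball C k)]|%fset.
  rewrite card_in_imfset// => x y; rewrite /= !mem_marked_ball => xk yk.
  rewrite /f; case: cid2 => s /= sl sx; case: cid2 => t /= tl ty st.
  rewrite -sx -ty; apply: (agree_word (agree_sym CD)) st.
  by rewrite (leq_trans _ km)// leq_add ?sl ?tl.
apply/fsubset_leq_card/fsubsetP => _ /imfsetP[x /= + ->].
rewrite !mem_marked_ball /f; case: cid2 => s /= <- _ sk.
exact: leq_trans (word_length_le _ _) sk.
Qed.

Lemma growth_submul A i j : (growth A (i + j) <= growth A i * growth A j)%N.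
Proof.
rewrite /growth -(size_allpairs (fun x y : A => x * y)).
apply: (uniq_leq_size (fset_uniq _)) => x; rewrite mem_marked_ball => xij.
have [s sl sx] := word_length_ex x.
apply/allpairsP; exists (word_val A (take i s), word_val A (drop i s)).
rewrite -word_val_cat cat_take_drop sx; split=> //=; rewrite mem_marked_ball.
  by rewrite (leq_trans (word_length_le _ _))// size_take_min geq_minl.
rewrite (leq_trans (word_length_le _ _))// size_drop sl; lia.
Qed.

Lemma growth_gt0 A m : (0 < growth A m)%N.
Proof.
rewrite cardfs_gt0; apply/fset0Pn; exists 1.
by rewrite mem_marked_ball word_length1.
Qed.

End Transfer.

Section GenTransfer.
Variable n : nat.
Implicit Types (A B : markedGroup n) (s t : seq 'I_n) (T : {set 'I_n}).

Lemma agree_gen_length A B m s : agree A B m -> (size s + size s <= m)%N ->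
  word_length (gen_prod A s) = word_length (gen_prod B s).
Proof.
by move=> AB ss; rewrite !gen_prodE; apply: (agree_word_length AB); rewrite !size_map.
Qed.

(** The successor accounts for the letter appended to [s] in order to test a descent. *)
Lemma agree_full_descent A B m T s : agree A B m -> {subset s <= T} ->
  ((size s).+1 + (size s).+1 <= m)%N ->
  full_descent A T (gen_prod A s) -> full_descent B T (gen_prod B s).
Proof.
move=> AB sT sm [_ desc]; split; first by exists s.
move=> i iT; have := desc i iT; rewrite /descent -!gen_prod_rcons.
rewrite !(agree_gen_length AB) ?size_rcons//.
by rewrite (leq_trans _ sm)// leq_add.
Qed.

End GenTransfer.

Local Open Scope ring_scope.

(** * Existence of growth rates *)

Section Fekete.
Variables (R : realType) (g : nat -> nat).
Hypotheses (g_gt0 : forall m, (0 < g m)%N)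
  (g_submul : forall i j, (g (i + j) <= g i * g j)%N).

Let root m : R := (g m)%:R `^ m%:R^-1.
(** The indices start at one because [root 0] is [1] by the convention [0^-1 = 0] and would spoil
    the infimum. *)
Let roots : set R := [set root m.+1 | m in setT].

Let g_ge1 m : 1 <= (g m)%:R :> R.
Proof. by rewrite ler1n. Qed.

Let root_ge1 m : 1 <= root m.
Proof. by rewrite -(powRr0 (g m)%:R) ler_powR// invr_ge0. Qed.

Let roots_lbound : lbound roots 1.
Proof. by move=> _ [m _ <-]. Qed.

Definition root_inf : R := inf roots.

Lemma root_inf_ge1 : 1 <= root_inf.
Proof. by apply: lb_le_inf roots_lbound; exists (root 1); exists 0%N. Qed.

Lemma root_inf_le m : (0 < m)%N -> root_inf <= root m.
Proof.
case: m => // m _; apply: ge_inf; last by exists m.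
by exists 1.
Qed.

Lemma root_inf_expr m : root_inf ^+ m <= (g m)%:R.
Proof.
case: m => [|m]; first by rewrite expr0.
rewrite -powR_mulrn ?(le_trans _ root_inf_ge1)//.
have -> : (g m.+1)%:R = root m.+1 `^ m.+1%:R :> R.
  by rewrite /root -powRrM mulVf ?pnatr_eq0// powRr1.
apply: ge0_ler_powR; rewrite ?nnegrE ?root_inf_le//.
  exact: le_trans root_inf_ge1.
exact: le_trans (root_ge1 _).
Qed.

Let g_mul q k p : (g (q * k + p) <= g k ^ q * g p)%N.
Proof.
elim: q => [|q IHq]; first by rewrite mul0n expn0 mul1n.
rewrite mulSn -addnA (leq_trans (g_submul _ _))// expnS -mulnA.
by rewrite leq_mul2l IHq orbT.
Qed.

Let g_le_expn p : (g p <= g 1 ^ p * g 0)%N.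
Proof. by have := g_mul p 1 0; rewrite muln1 addn0. Qed.

(** Divide [m] by [k]: submultiplicativity bounds [g m] by a power of [g k] times a factor that
    depends on [k] only, and the [m]-th root of that factor tends to [1]. *)
Let root_le k m : (0 < k)%N -> (0 < m)%N ->
  root m <= root k * (g 1 ^ k * g 0)%:R `^ m%:R^-1.
Proof.
move=> k0 m0; have m0' : 0 < m%:R :> R by rewrite ltr0n.
have gm : (g m <= g k ^ (m %/ k) * (g 1 ^ k * g 0))%N.
  rewrite {1}(divn_eq m k) (leq_trans (g_mul _ _ _))// leq_mul2l.
  rewrite (leq_trans (g_le_expn _)) ?orbT// leq_mul2r leq_pexp2l ?orbT//.
  by rewrite ltnW// ltn_mod.
rewrite /root (@le_trans _ _ ((g k ^ (m %/ k) * (g 1 ^ k * g 0))%:R `^ m%:R^-1))//.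
  by apply: ge0_ler_powR; rewrite ?nnegrE ?ler_nat ?invr_ge0.
rewrite natrM powRM// ler_pM2r; last by rewrite powR_gt0// ltr0n muln_gt0 expn_gt0 !g_gt0.
rewrite natrX -powR_mulrn// -powRrM ler_powR//.
rewrite -[leRHS]mul1r ler_pdivrMr// mulrAC ler_pdivlMr ?ltr0n// -natrM mul1r ler_nat.
exact: leq_trunc_div.
Qed.

Lemma cvg_powR_inv (c : R) : 0 < c -> c `^ m%:R^-1 @[m --> \oo] --> (1 : R).
Proof.
move=> c0; rewrite -cvg_shiftS /=.
rewrite [X in X @ _ --> _](_ : _ = (fun m => expR (m.+1%:R^-1 * ln c))); last first.
  by apply/funext => m; rewrite /powR gt_eqF.
suff : expR (m.+1%:R^-1 * ln c) @[m --> \oo] --> expR (0 * ln c).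
  by rewrite mul0r expR0.
apply: (@cvg_comp _ _ _ _ expR); last exact: continuous_expR.
by apply: cvgMr_tmp; exact: cvg_harmonic.
Qed.

Lemma fekete : root m @[m --> \oo] --> root_inf.
Proof.
apply/cvgrPdist_lt => e e0.
have hinf : has_inf roots by split; [exists (root 1); exists 0%N|exists 1].
have [_ [k _ <-] rk] := inf_adherent e0 hinf.
have C0 : 0 < (g 1 ^ k.+1 * g 0)%:R :> R.
  by rewrite ltr0n muln_gt0 expn_gt0 !g_gt0.
have lim_rk : root k.+1 * (g 1 ^ k.+1 * g 0)%:R `^ m%:R^-1 @[m --> \oo] --> root k.+1.
  rewrite -{2}[root k.+1]mulr1; apply: cvgMl_tmp; exact: cvg_powR_inv.
near=> m.
have m0 : (0 < m)%N by near: m; exact: nbhs_infty_gt.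
rewrite distrC ger0_norm ?subr_ge0 ?root_inf_le// ltrBlDl.
apply: le_lt_trans (root_le (ltn0Sn k) m0) _.
by near: m; apply: (cvgr_lt _ lim_rk).
Unshelve. all: by end_near. Qed.

End Fekete.

(** * Growth series *)

(** Expand the product over [i] of [(if i \in A then -1 else 0) + 1], which has a zero factor unless
    [A] is empty. *)
Lemma sum_sign_subset (R : comRingType) (I : finType) (A : {set I}) :
  \sum_(U : {set I} | U \subset A) (-1) ^+ #|U| = (A == finset.set0)%:R :> R.
Proof.
have prodE : \prod_(i : I) ((if i \in A then -1 else 0) + 1) = (A == finset.set0)%:R :> R.
  case: (finset.set_0Vmem A) => [->|[i iA]].
    by rewrite eqxx big1// => i _; rewrite finset.in_set0 add0r.
  rewrite (bigD1 i)//= iA addNr mul0r; case: eqP => // A0.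
  by rewrite A0 finset.in_set0 in iA.
rewrite -prodE bigA_distr [RHS](bigID (fun U : {set I} => U \subset A))/=.
rewrite [X in _ + X]big1 ?addr0 => [|U /fintype.subsetPn[i iU iA]]; last first.
  by rewrite (bigD1 i)//= iU (negPf iA) mul0r.
apply: eq_bigr => U /fintype.subsetP UA.
rewrite -big_mkcond/= (eq_bigr (fun=> -1)) => [|i /UA ->//].
by rewrite prodr_const.
Qed.

(** Inclusion-exclusion with the negative terms moved across, so that it can be summed over group
    elements in the extended reals without subtraction. *)
Lemma sum_even_subset (R : numDomainType) (I : finType) (T A : {set I}) (x : R) :
  A \subset T ->
  \sum_(U : {set I} | (U \subset T) && ~~ odd #|U|) (if U \subset A then x else 0) =
  \sum_(U : {set I} | (U \subset T) && odd #|U|) (if U \subset A then x else 0) +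
  (if A == finset.set0 then x else 0).
Proof.
move=> AT; apply/eqP; rewrite addrC -subr_eq -sumrN; apply/eqP.
transitivity (\sum_(U : {set I} | U \subset T) (-1) ^+ #|U| * (if U \subset A then x else 0)).
  rewrite [RHS](bigID (fun U : {set I} => odd #|U|))/= addrC; congr (_ + _).
    by apply: eq_bigr => U /andP[_ oU]; rewrite -signr_odd (negPf oU) mul1r.
  by apply: eq_bigr => U /andP[_ oU]; rewrite -signr_odd oU mulN1r.
under eq_bigr do rewrite -mulrb -[_ *+ _]mulr_natr mulrCA mulrC.
rewrite -mulr_suml -mulrb -mulr_natl -sum_sign_subset; congr (_ * _).
rewrite big_mkcond [RHS]big_mkcond; apply: eq_bigr => U _.
have [UA|] := boolP (U \subset A); last by rewrite mulr0 if_same.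
by rewrite (fintype.subset_trans UA AT) mulr1.
Qed.

Lemma esumZl (R : realType) (I : choiceType) (S : set I) (a : R) (f : I -> \bar R) :
  0 <= a -> (forall i, (0 <= f i)%E) ->
  (\esum_(i in S) (a%:E * f i) = a%:E * \esum_(i in S) f i)%E.
Proof.
move=> a0 f0; rewrite /esum -ereal_supZl//; last first.
  by apply/set0P; exists (\sum_(x \in set0) f x)%E, set0 => //; exact: fsets_set0.
congr ereal_sup; rewrite image_comp; apply: eq_imagel => X _ /=.
by rewrite ge0_mule_fsumr.
Qed.

Section GrowthSeries.
Variables (R : realType) (n : nat) (A : markedGroup n).
Implicit Types (D : set A) (T U : {set 'I_n}) (t : R).

Definition growth_series D t : \bar R := (\esum_(w in D) (t ^+ word_length w)%:E)%E.

Lemma growth_series_ge0 D t : 0 <= t -> (0 <= growth_series D t)%E.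
Proof. by move=> t0; apply: esum_ge0 => w _; rewrite lee_fin exprn_ge0. Qed.

Lemma growth_series_sub D D' t : 0 <= t -> D `<=` D' ->
  (growth_series D t <= growth_series D' t)%E.
Proof.
move=> t0 DD'; rewrite /growth_series esum_mkcond [leRHS]esum_mkcond.
apply: le_esum => w _; case: ifPn => [/set_mem/DD'/mem_set->//|_].
by case: ifP => // _; rewrite lee_fin exprn_ge0.
Qed.

Lemma growth_series1 t : growth_series [set 1%g] t = 1%E.
Proof. by rewrite /growth_series esum_set1 word_length1 ?expr0// lee_fin. Qed.

Variable eta : A -> A -> bool.
Hypothesis etaP : reflection_cocycle eta.

(** Lengths add along the bijection with minimal representatives, so the double sum factors;
    finiteness at [U] allows that factor to be pulled out as a real scalar. *)
Lemma growth_series_coset T U t : 0 <= t -> U \subset T ->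
  (growth_series (parabolic A U) t < +oo)%E ->
  growth_series (parabolic A T) t =
    (growth_series (min_coset_rep A T U) t * growth_series (parabolic A U) t)%E.
Proof.
move=> t0 UT Uoo.
have Ufin : growth_series (parabolic A U) t \is a fin_num.
  by rewrite ge0_fin_numE// growth_series_ge0.
rewrite [LHS](@reindex_esum _ _ _ _ _ _ _ (min_coset_rep_bij etaP UT)).
rewrite (_ : _ `*` _ = min_coset_rep A T U `*`` (fun=> parabolic A U)); last first.
  by apply/seteqP; split.
transitivity (\esum_(p in min_coset_rep A T U `*`` (fun=> parabolic A U))
   ((t ^+ word_length p.1)%:E * (t ^+ word_length p.2)%:E))%E.
  apply: eq_esum => -[u v] /= [[_ asc] Uv].
  by rewrite (length_coset etaP asc Uv) exprD EFinM.
rewrite -(esum_esum (a := fun u v => ((t ^+ word_length u)%:E * (t ^+ word_length v)%:E)%E)); last first.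
  by move=> u v _ _; rewrite mule_ge0// lee_fin exprn_ge0.
rewrite muleC -[X in (X * _)%E]fineK// -esumZl; last 2 first.
- by rewrite fine_ge0// growth_series_ge0.
- by move=> w; rewrite lee_fin exprn_ge0.
apply: eq_esum => u _; rewrite esumZl ?exprn_ge0//; last first.
  by move=> w; rewrite lee_fin exprn_ge0.
by rewrite muleC fineK.
Qed.

(** The numerator [t^N] of the recursion, zero when there is no full descent; [full_descent_unique]
    makes the chosen element well determined. *)
Definition top_term T t : R :=
  if pselect (exists w, full_descent A T w) is left ex_top
  then t ^+ word_length (projT1 (cid ex_top)) else 0.

Lemma growth_series_full_descent T t : 0 <= t ->
  growth_series (full_descent A T) t = (top_term T t)%:E.
Proof.
move=> t0; rewrite /top_term; case: pselect => [ex|Nex].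
  case: cid => /= w Dw; rewrite (_ : full_descent A T = [set w]); last first.
    apply/seteqP; split=> [w' Dw'|_ ->//].
    exact: (full_descent_unique etaP Dw').
  by rewrite /growth_series esum_set1// lee_fin exprn_ge0.
rewrite /growth_series (_ : full_descent A T = set0) ?esum_set0//.
by apply/seteqP; split=> // w Dw; apply: Nex; exists w.
Qed.

Lemma growth_series_parabolic_cond T (Q : set A) t :
  growth_series (parabolic A T `&` Q) t =
    (\esum_(w in parabolic A T) (if w \in Q then t ^+ word_length w else 0)%:E)%E.
Proof.
by rewrite /growth_series esum_mkcondr; apply: eq_esum => w _; case: ifP.
Qed.

(** An element [w] is a minimal representative for [U] exactly when [U] lies in its ascent set
    [asc w]. Inclusion-exclusion over [U] therefore leaves the elements without ascents in [T]. *)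
Lemma growth_series_alternating_ereal T t : 0 <= t ->
  (\sum_(U : {set 'I_n} | (U \subset T) && ~~ odd #|U|)
      growth_series (min_coset_rep A T U) t =
   \sum_(U : {set 'I_n} | (U \subset T) && odd #|U|)
      growth_series (min_coset_rep A T U) t + (top_term T t)%:E)%E.
Proof.
move=> t0; rewrite -growth_series_full_descent//.
pose c w (b : bool) := (if b then t ^+ @word_length n A w else 0).
have c0 w b : (0 <= (c w b)%:E)%E by rewrite lee_fin /c; case: b; rewrite ?exprn_ge0.
pose asc w : {set 'I_n} := finset.finset (fun i => (i \in T) && ~~ @descent n A w i).
have gsE U : U \subset T -> growth_series (min_coset_rep A T U) t =
    (\esum_(w in parabolic A T) (c w (U \subset asc w))%:E)%E.
  move=> /fintype.subsetP UT; rewrite growth_series_parabolic_cond.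
  apply: eq_esum => w _; rewrite /c; congr (if _ then _ else _)%:E.
  apply/idP/fintype.subsetP => [/set_mem ascU i iU|ascU].
    by rewrite finset.inE UT//= ascU.
  by apply/mem_set => i /ascU; rewrite finset.inE => /andP[].
have gsT : growth_series (full_descent A T) t =
    (\esum_(w in parabolic A T) (c w (asc w == finset.set0))%:E)%E.
  rewrite growth_series_parabolic_cond.
  apply: eq_esum => w _; rewrite /c; congr (if _ then _ else _)%:E.
  apply/idP/eqP => [/set_mem desc|asc0].
    apply/finset.setP => i; rewrite finset.inE finset.in_set0.
    by apply/negP => /andP[/desc ->].
  apply/mem_set => i iT; move/finset.setP/(_ i): asc0.
  by rewrite finset.inE finset.in_set0 iT /= => /negbFE.
under eq_bigr => U /andP[UT _] do rewrite gsE//.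
under [in RHS]eq_bigr => U /andP[UT _] do rewrite gsE//.
rewrite gsT -!esum_sum// -esumD//; last by move=> w _; apply: sume_ge0.
apply: eq_esum => w _; rewrite !sumEFin -EFinD; congr _%:E.
apply: sum_even_subset; apply/fintype.subsetP => i.
by rewrite finset.inE => /andP[].
Qed.

Lemma growth_series_fin D T t : 0 <= t -> D `<=` parabolic A T ->
  (growth_series (parabolic A T) t < +oo)%E -> growth_series D t \is a fin_num.
Proof.
move=> t0 DT Too; rewrite ge0_fin_numE ?growth_series_ge0//.
exact: le_lt_trans (growth_series_sub t0 DT) Too.
Qed.

Lemma growth_series_alternating T t : 0 <= t ->
  (growth_series (parabolic A T) t < +oo)%E ->
  \sum_(U : {set 'I_n} | U \subset T)
     (-1) ^+ #|U| * fine (growth_series (min_coset_rep A T U) t) = top_term T t.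
Proof.
move=> t0 Too.
have gfin U : growth_series (min_coset_rep A T U) t \is a fin_num.
  by apply: growth_series_fin Too => // w [].
have := growth_series_alternating_ereal T t0.
under eq_bigr do rewrite -[growth_series _ _]fineK//.
under [in RHS]eq_bigr do rewrite -[growth_series _ _]fineK//.
rewrite !sumEFin -EFinD => -[evenE].
rewrite (bigID (fun U : {set 'I_n} => odd #|U|))/=.
rewrite [X in _ + X](eq_bigr (fun U => fine (growth_series (min_coset_rep A T U) t))); last first.
  by move=> U /andP[_ oU]; rewrite -signr_odd (negPf oU) mul1r.
rewrite evenE addrA -big_split big1 ?add0r// => U /andP[_ oU] /=.
by rewrite -signr_odd oU mulN1r addNr.
Qed.

(* [k] is only fuel: the value at [T] is the intended one for [#|T| <= k]. *)
Fixpoint inv_growth k T t : R :=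
  if k is k'.+1 then
    if T == finset.set0 then 1
    else - (\sum_(U : {set 'I_n} | U \proper T) (-1) ^+ #|U| * inv_growth k' U t)
         / ((-1) ^+ #|T| - top_term T t)
  else 1.

Lemma top_term_ge0 T t : 0 <= t -> 0 <= top_term T t.
Proof. by move=> t0; rewrite /top_term; case: pselect => // ?; rewrite exprn_ge0. Qed.

Lemma top_term_lt1 T t : 0 <= t < 1 -> T != finset.set0 -> top_term T t < 1.
Proof.
move=> /andP[t0 t1] /finset.set0Pn[i iT]; rewrite /top_term; case: pselect => // ex.
case: cid => w [_ /(_ i iT)] /= /(leq_ltn_trans (leq0n _)) lw.
by rewrite exprn_ilt1// -lt0n.
Qed.

(** An element with a descent has positive length, so the top term lies in [[0, 1)] and cannot equal
    a sign. This excludes poles on [[0, 1)]. *)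
Lemma inv_growth_den T t : 0 <= t < 1 -> T != finset.set0 ->
  (-1) ^+ #|T| - top_term T t != 0.
Proof.
move=> t01 T0; have := top_term_lt1 t01 T0.
have /(top_term_ge0 T) : 0 <= t by case/andP: t01.
rewrite -signr_odd; case: odd; rewrite ?expr1 ?expr0; lra.
Qed.

(** Divide the alternating identity by the series of [T] and solve for the inverse of that series:
    the term [U = T] contributes the sign in the denominator, and by the coset factorization each
    proper [U] contributes the inverse of its own series. *)
Lemma inv_growthP k T t : (#|T| <= k)%N -> 0 <= t < 1 ->
  (growth_series (parabolic A T) t < +oo)%E ->
  inv_growth k T t * fine (growth_series (parabolic A T) t) = 1.
Proof.
have base t' : growth_series (parabolic A finset.set0) t' = 1%E.
  rewrite (_ : parabolic A finset.set0 = [set 1%g]) ?growth_series1//.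
  apply/seteqP; split=> [w [[|i s] sT <-]|_ ->]; last exact: parabolic1.
    by rewrite /gen_prod big_nil.
  by have := sT i; rewrite inE eqxx finset.in_set0 => /(_ isT).
elim: k T => [|k IHk] T Tk /[dup] t01 /andP[t0 t1] Too.
  have -> : T = finset.set0 by apply/eqP; rewrite -cards_eq0 -leqn0.
  by rewrite base /= mulr1.
rewrite /=; case: eqVneq => [->|T0]; first by rewrite base mulr1.
have Tfin := growth_series_fin t0 (@subset_refl _ _) Too.
set W := fine _.
rewrite -[RHS](mulfV (inv_growth_den t01 T0)) mulrAC; congr (_ / _).
rewrite -growth_series_alternating// [in RHS](bigD1 T)//= (min_coset_repTT etaP).
rewrite growth_series1 mulr1 opprD addrA subrr add0r mulNr; congr (- _).
rewrite mulr_suml; apply: eq_big => [U|U UT]; first by rewrite finset.properEneq andbC.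
rewrite -mulrA; congr (_ * _).
have sUT := fintype.proper_sub UT.
have Uoo : (growth_series (parabolic A U) t < +oo)%E.
  exact: le_lt_trans (growth_series_sub t0 (parabolicS sUT)) Too.
have Uk : (#|U| <= k)%N by rewrite -ltnS (leq_trans (fintype.proper_card UT)).
have XU : min_coset_rep A T U `<=` parabolic A T by move=> w [].
rewrite /W (growth_series_coset t0 sUT Uoo) fineM; last 2 first.
- exact: growth_series_fin Too.
- exact: growth_series_fin Uoo.
by rewrite mulrCA IHk// mulr1.
Qed.

Lemma inv_growth_full t : 0 <= t < 1 -> (growth_series setT t < +oo)%E ->
  inv_growth n finset.setT t * fine (growth_series setT t) = 1.
Proof.
move=> t01; have -> : setT = parabolic A finset.setT.
  apply/seteqP; split=> // w _; have [s _ <-] := gen_prod_ex etaP w.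
  by exists s => // i _; rewrite finset.in_setT.
by move=> ?; rewrite inv_growthP// cardsT card_ord.
Qed.

End GrowthSeries.

Arguments growth_series {R n A} D t.
Arguments top_term {R n} A T t.
Arguments inv_growth {R n} A k T t.

(** * Growth rate and convergence of the growth series *)

Section GrowthRate.
Variables (R : realType) (n : nat).
Implicit Types (A B : markedGroup n) (t : R).

Lemma growth_rateP A :
  (growth A m)%:R `^ m%:R^-1 @[m --> \oo] --> root_inf R (growth A).
Proof. exact: (@fekete R _ (@growth_gt0 _ A) (@growth_submul _ A)). Qed.

Lemma growth_rate_inf A : growth_rate_of R A = root_inf R (growth A).
Proof. by apply: cvg_lim => //; exact: growth_rateP. Qed.

Lemma growth_rate_ge1 A : 1 <= growth_rate_of R A.
Proof. by rewrite growth_rate_inf root_inf_ge1//; exact: growth_gt0. Qed.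

Lemma growth_rate_expr A m : growth_rate_of R A ^+ m <= (growth A m)%:R.
Proof. by rewrite growth_rate_inf root_inf_expr//; exact: growth_gt0. Qed.

Lemma sum_marked_ball A m t : 0 <= t -> t <= 1 ->
  (growth A m)%:R * t ^+ m <= \sum_(x <- fset_set (marked_ball A m)) t ^+ word_length x.
Proof.
move=> t0 t1; have -> : (growth A m)%:R * t ^+ m =
    \sum_(x <- fset_set (marked_ball A m)) t ^+ m.
  by rewrite big_const_seq count_predT iter_addr_0 mulr_natl.
rewrite big_seq [leRHS]big_seq; apply: ler_sum => x; rewrite mem_marked_ball => xm.
by rewrite ler_wiXn2l.
Qed.

Lemma growth_series_ge_ball A m t : 0 <= t -> t <= 1 ->
  (((growth A m)%:R * t ^+ m)%:E <= growth_series (@setT A) t)%E.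
Proof.
move=> t0 t1; apply: esum_ge; exists (marked_ball A m).
  by split=> //; exact: marked_ball_finite.
rewrite fsbig_finite/=; last exact: marked_ball_finite.
by rewrite sumEFin lee_fin sum_marked_ball.
Qed.

Lemma growth_le_geometric A (c : R) : growth_rate_of R A < c ->
  exists C, forall m, (growth A m)%:R <= C * c ^+ m.
Proof.
move=> rate_c; have c1 : 1 <= c by rewrite (le_trans (growth_rate_ge1 A))// ltW.
have c0 : 0 <= c by rewrite (le_trans ler01).
have /cvgrPdist_lt/(_ (c - growth_rate_of R A)) := @growth_rateP A.
rewrite subr_gt0 => /(_ rate_c)[N _ NP].
(* The sum takes care of the finitely many [m <= N], the summand [1] of all larger [m]. *)
exists (1 + \sum_(k < N.+1) (growth A k)%:R) => m.
have Cge1 : 1 <= 1 + \sum_(k < N.+1) (growth A k)%:R :> R by rewrite lerDl sumr_ge0.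
have cm1 : 1 <= c ^+ m by rewrite exprn_ege1.
case: (ltnP m N.+1) => [mN|Nm].
  apply: (@le_trans _ _ (1 + \sum_(k < N.+1) (growth A k)%:R)); last first.
    by rewrite ler_peMr// (le_trans ler01).
  by rewrite (bigD1 (Ordinal mN))//= addrCA lerDl addr_ge0// sumr_ge0.
apply: (@le_trans _ _ (c ^+ m)); last by rewrite ler_peMl// exprn_ge0.
have := NP m (ltnW Nm) => /=; rewrite distrC => /(le_lt_trans (ler_norm _)).
rewrite growth_rate_inf ltrD2r => /ltW.
case: m {cm1} Nm => // m _ root_c.
have -> : (growth A m.+1)%:R = ((growth A m.+1)%:R `^ m.+1%:R^-1) `^ m.+1%:R :> R.
  by rewrite -powRrM mulVf ?pnatr_eq0// powRr1.
by rewrite -powR_mulrn//; apply: ge0_ler_powR; rewrite ?nnegrE ?powR_ge0.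
Qed.

Lemma sphere_series A t k : 0 <= t ->
  (growth_series [set w : A | word_length w = k] t <= ((growth A k)%:R * t ^+ k)%:E)%E.
Proof.
move=> t0; rewrite /growth_series.
have sub : [set w : A | word_length w = k] `<=` marked_ball A k.
  by move=> w /= wk; rewrite /marked_ball /= wk.
have fin : finite_set [set w : A | word_length w = k].
  by apply: sub_finite_set sub _; exact: marked_ball_finite.
rewrite esum_fset//; last by move=> w _; rewrite lee_fin exprn_ge0.
rewrite fsbig_finite// sumEFin lee_fin.
rewrite big_seq (eq_bigr (fun=> t ^+ k)); last first.
  by move=> w; rewrite in_fset_set// => /set_mem /= ->.
rewrite -big_seq big_const_seq count_predT iter_addr_0.
rewrite mulr_natl ler_wpMn2l ?exprn_ge0//.
apply: fsubset_leq_card; rewrite -fset_set_sub//; exact: marked_ball_finite.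
Qed.

Lemma geometric_sum_le (q : R) k : 0 <= q -> q < 1 ->
  \sum_(i < k) q ^+ i <= (1 - q)^-1.
Proof.
move=> q0 q1; have q1' : 0 < 1 - q by rewrite subr_gt0.
rewrite -[leRHS]mul1r ler_pdivlMr// -lerN2 -mulrN opprB mulrC -subrX1.
by rewrite lerBrDl subrr exprn_ge0.
Qed.

Lemma growth_series_lty A t : 0 <= t -> growth_rate_of R A * t < 1 ->
  (growth_series (@setT A) t < +oo)%E.
Proof.
move=> t0 rate_t.
(* A rate [c] strictly between the growth rate and [t^-1] leaves room for a geometric majorant of
   ratio [c * t]; [t = 0] is separate because its inverse is [0]. *)
have [c [rate_c ct]] : exists c, growth_rate_of R A < c /\ c * t < 1.
  have [->|tN0] := eqVneq t 0.
    by exists (growth_rate_of R A + 1); rewrite mulr0 ltrDl !ltr01.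
  have tp : 0 < t by rewrite lt_neqAle eq_sym tN0.
  have : growth_rate_of R A < t^-1 by rewrite -[ltRHS]mul1r ltr_pdivlMr.
  by move=> /midf_lt[lo hi]; exists ((growth_rate_of R A + t^-1) / 2); rewrite -ltr_pdivlMr ?mul1r.

have c0 : 0 <= c by rewrite (le_trans _ (ltW rate_c))// (le_trans ler01)// growth_rate_ge1.
have [C CP] : exists C, forall m, (growth A m)%:R <= C * c ^+ m.
  exact: growth_le_geometric.
have -> : @setT A = \bigcup_k [set w : A | word_length w = k].
  by apply/seteqP; split=> // w _; exists (word_length w).
rewrite /growth_series nneseries_sum_bigcup; last 2 first.
- by move=> i j _ _ [w [/= <- <-]].
- by move=> w; rewrite lee_fin exprn_ge0.
have C0 : 0 <= C by have := CP 0; rewrite expr0 mulr1; apply: le_trans.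
apply: (@le_lt_trans _ _ (C * (1 - c * t)^-1)%:E); last exact: ltry.
apply: lime_le.
  by apply: is_cvg_nneseries => k _ _; apply: growth_series_ge0.
near=> N; rewrite big_mkord.
apply: (@le_trans _ _ (\sum_(k < N) ((growth A k)%:R * t ^+ k)%:E)%E).
  by apply: lee_sum => k _; exact: sphere_series.
rewrite sumEFin lee_fin.
apply: (@le_trans _ _ (C * \sum_(k < N) (c * t) ^+ k)).
  rewrite mulr_sumr; apply: ler_sum => k _.
  by rewrite exprMn mulrA ler_wpM2r// exprn_ge0.
by rewrite ler_wpM2l// geometric_sum_le// mulr_ge0.
Unshelve. all: by end_near. Qed.

End GrowthRate.

(** * Semicontinuity of the growth rate *)

Section RationalFunctions.
Variable R : realType.

Definition rational_on01 (f : R -> R) : Prop :=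
  exists P Q : {poly R}, forall t, 0 <= t < 1 -> Q.[t] != 0 /\ f t = P.[t] / Q.[t].

Lemma rational_on01_add f g :
  rational_on01 f -> rational_on01 g -> rational_on01 (fun t => f t + g t).
Proof.
move=> [P [Q PQ]] [P' [Q' PQ']]; exists (P * Q' + P' * Q), (Q * Q') => t t01.
have [Q0 ->] := PQ t t01; have [Q'0 ->] := PQ' t t01.
by rewrite !hornerE mulf_neq0// addf_div.
Qed.

Lemma rational_on01_mul f g :
  rational_on01 f -> rational_on01 g -> rational_on01 (fun t => f t * g t).
Proof.
move=> [P [Q PQ]] [P' [Q' PQ']]; exists (P * P'), (Q * Q') => t t01.
have [Q0 ->] := PQ t t01; have [Q'0 ->] := PQ' t t01.
by rewrite !hornerM mulf_neq0// mulf_div.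
Qed.

Lemma rational_on01_inv (P : {poly R}) : (forall t, 0 <= t < 1 -> P.[t] != 0) ->
  rational_on01 (fun t => P.[t]^-1).
Proof. by move=> P0; exists 1, P => t /P0; rewrite hornerC div1r. Qed.

Lemma rational_on01_sum (I : Type) (r : seq I) (Q : pred I) (f : I -> R -> R) :
  (forall i, rational_on01 (f i)) ->
  rational_on01 (fun t => \sum_(i <- r | Q i) f i t).
Proof.
move=> ratf; elim: r => [|i r IHr].
  exists 0, 1 => t _; rewrite big_nil !hornerC oner_eq0; split=> //.
  by rewrite mul0r.
under [X in rational_on01 X]eq_fun do rewrite big_cons.
by case: (Q i) => //; exact: rational_on01_add.
Qed.

Lemma poly_eq0_itv (P : {poly R}) (a b : R) : a < b ->
  (forall t, a < t < b -> P.[t] = 0) -> P = 0.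
Proof.
move=> ab Pab; apply/eqP; apply: contraT => P0.
(* As many distinct roots as the size of [P]; the shift [i.+2] keeps them strictly between [a] and
   [b]. *)
pose pt i : R := a + (b - a) / i.+2%:R.
have ba : 0 < b - a by rewrite subr_gt0.
have pt_inj : injective pt.
  move=> i j /addrI /(mulfI (lt0r_neq0 ba)) /invr_inj /eqP.
  by rewrite eqr_nat => /eqP [].
have := @max_poly_roots _ P [seq pt i | i <- iota 0 (size P)] P0.
rewrite size_map size_iota ltnn => -> //; last by rewrite map_inj_uniq// iota_uniq.
apply/allP => _ /mapP[i _ ->]; apply/rootP/Pab.
rewrite /pt ltrDl divr_gt0//= -ltrBrDl ltr_pdivrMr// ltr_pMr//.
by rewrite ltr1n.
Qed.

End RationalFunctions.

Definition coxeter_like n (A : markedGroup n) : Prop :=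
  exists eta : A -> A -> bool, reflection_cocycle eta.

Section Continuity.
Variables (R : realType) (n : nat).
Implicit Types (A : markedGroup n) (T : {set 'I_n}) (t : R).

Lemma top_termE A T t w : coxeter_like A -> full_descent A T w ->
  top_term A T t = t ^+ word_length w.
Proof.
move=> [eta etaP] Dw; rewrite /top_term; case: pselect => [ex|[]]; last by exists w.
by case: cid => w' /= Dw'; rewrite (full_descent_unique etaP Dw Dw').
Qed.

Lemma top_term0 A T t : ~ (exists w, full_descent A T w) -> top_term A T t = 0.
Proof. by rewrite /top_term; case: pselect. Qed.

Lemma top_term_poly A T : coxeter_like A -> exists P, forall t, top_term A T t = P.[t].
Proof.
move=> coxA; have [[w Dw]|N] := pselect (exists w, full_descent A T w).
  by exists 'X^(word_length w) => t; rewrite (top_termE _ coxA Dw) hornerXn.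
by exists 0 => t; rewrite top_term0// horner0.
Qed.

Lemma full_descent_word A T w : coxeter_like A -> full_descent A T w ->
  exists s : seq 'I_n, [/\ {subset s <= T}, size s = word_length w & gen_prod A s = w].
Proof. by move=> [eta etaP] [Tw _]; exact: (parabolic_reduced etaP Tw). Qed.

Lemma inv_growth_rational A k T : coxeter_like A ->
  rational_on01 (inv_growth A k T : R -> R).
Proof.
move=> coxA; elim: k T => [|k IHk] T /=; first by exists 1, 1 => t _; rewrite hornerC oner_eq0 divr1.
case: eqVneq => [_|T0]; first by exists 1, 1 => t _; rewrite hornerC oner_eq0 divr1.
have [P PE] := top_term_poly T coxA.
have signE m (t : R) : ((-1) ^+ m : R) = ((-1) ^+ m)%:P.[t] by rewrite hornerC.
apply: rational_on01_mul; last first.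
  under [X in rational_on01 X]eq_fun => t do
    rewrite PE (signE _ t) -hornerN -hornerD.
  apply: rational_on01_inv => t t01.
  by rewrite hornerD hornerN -PE hornerC inv_growth_den.
under [X in rational_on01 X]eq_fun => t do rewrite -mulN1r.
apply: rational_on01_mul.
  by exists (-1)%:P, 1 => t _; rewrite !hornerC oner_eq0 divr1.
apply: rational_on01_sum => U; apply: rational_on01_mul => //.
by exists ((-1) ^+ #|U|)%:P, 1 => t _; rewrite !hornerC oner_eq0 divr1.
Qed.

Lemma cvg_half : m./2 @[m --> \oo] --> \oo.
Proof.
apply/cvgnyPge => N; near=> m.
by rewrite geq_half_double; near: m; exact: nbhs_infty_ge.
Unshelve. all: by end_near. Qed.

Lemma cvg_expr_half (q : R) : 0 <= q < 1 -> q ^+ m./2 @[m --> \oo] --> (0 : R).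
Proof.
move=> /andP[q0 q1]; apply: (cvg_comp _ _ cvg_half).
by apply: cvg_expr; rewrite ger0_norm.
Qed.

Section Limit.
Variables (A : markedGroup n) (B : nat -> markedGroup n).
Hypotheses (coxA : coxeter_like A) (coxB : forall m, coxeter_like (B m)).
Hypothesis AB : forall m, agree A (B m) m.

(** A full descent of [A] is also one of [B m], with the same length, for large [m], so the term is
    eventually constant. If [A] has none, any full descent of [B m] has length at least [m./2], for
    otherwise it would transfer back, and the term is at most [t ^+ m./2]. *)
Lemma top_term_cvg T t : 0 <= t < 1 -> top_term (B m) T t @[m --> \oo] --> top_term A T t.
Proof.
move=> /[dup] t01 /andP[t0 t1].
have [[w Dw]|noD] := pselect (exists w, full_descent A T w).
  have [s [sT sl sE]] := full_descent_word coxA Dw.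
  rewrite (top_termE _ coxA Dw); apply: cvg_near_cst; near=> m.
  have sm : ((size s).+1 + (size s).+1 <= m)%N by near: m; exact: nbhs_infty_ge.
  rewrite -sE in Dw *.
  rewrite (top_termE _ (coxB m) (agree_full_descent (AB m) sT sm Dw)).
  by rewrite (agree_gen_length (AB m))// (leq_trans _ sm)// leq_add.
rewrite (top_term0 _ noD).
apply: (@squeeze_cvgr _ _ _ _ (fun=> 0) (fun m => t ^+ m./2)); last 2 first.
- exact: cvg_cst.
- exact: cvg_expr_half.
near=> m; rewrite top_term_ge0//=.
have [[w Dw]|noDm] := pselect (exists w, full_descent (B m) T w); last first.
  by rewrite (top_term0 _ noDm) exprn_ge0.
rewrite (top_termE _ (coxB m) Dw); have [s [sT sl sE]] := full_descent_word (coxB m) Dw.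
rewrite ler_wiXn2l ?(ltW t1)//; case: (leqP ((size s).+1 + (size s).+1) m) => sm.
  exfalso; apply: noD; exists (gen_prod A s).
  by apply: (agree_full_descent (agree_sym (AB m)) sT sm); rewrite sE.
by rewrite -sl -ltnS; lia.
Unshelve. all: by end_near. Qed.

Lemma inv_growth_cvg k T t : 0 <= t < 1 ->
  inv_growth (B m) k T t @[m --> \oo] --> inv_growth A k T t.
Proof.
move=> t01; elim: k T => [|k IHk] T /=; first exact: cvg_cst.
case: eqVneq => [_|T0]; first exact: cvg_cst.
apply: cvgM; last first.
  apply: cvgV; first exact: inv_growth_den.
  by apply: cvgB; [exact: cvg_cst|exact: top_term_cvg].
apply: cvgN; apply: cvg_big => [|U _]; first exact: add_continuous.
by apply: cvgM; [exact: cvg_cst|exact: IHk].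
Qed.

Lemma inv_growth_limit_eq0 (c t : R) : (forall m, growth_rate_of R (B m) <= c) ->
  0 < t < 1 -> c * t < 1 -> 1 < growth_rate_of R A * t ->
  inv_growth A n finset.setT t = 0.
Proof.
move=> rateB /andP[t0 t1] ct At.
have t01 : 0 <= t < 1 by rewrite ltW.
have qt : 0 <= (growth_rate_of R A * t)^-1 < 1.
  by rewrite invf_lt1 ?At ?invr_ge0 ?(ltW (lt_trans ltr01 At))// (lt_trans ltr01).
apply: (@cvg_unique _ _ (inv_growth (B m) n finset.setT t @[m --> \oo])) => //.
  exact: inv_growth_cvg.
apply: (@squeeze_cvgr _ _ _ _ (fun=> 0) (fun m => (growth_rate_of R A * t)^-1 ^+ m./2)); last 2 first.
- exact: cvg_cst.
- exact: cvg_expr_half.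
apply: nearW => m /=.
have [eta etaP] := coxB m.
have Boo : (growth_series (@setT (B m)) t < +oo)%E.
  apply: growth_series_lty (ltW t0) _; apply: le_lt_trans ct.
  by rewrite ler_wpM2r// ltW.
have Bfin : growth_series (@setT (B m)) t \is a fin_num.
  by rewrite ge0_fin_numE ?growth_series_ge0 ?(ltW t0).
have WF := inv_growth_full etaP t01 Boo.
(* Agreement up to radius [m] equates the ball sizes up to [m./2], and for [A] these are at least
   the powers of its growth rate. *)
have lbW : (growth_rate_of R A * t) ^+ m./2 <= fine (growth_series (@setT (B m)) t).
  rewrite -lee_fin fineK//.
  apply: le_trans (growth_series_ge_ball _ m./2 (ltW t0) (ltW t1)).
  rewrite lee_fin exprMn ler_wpM2r ?exprn_ge0 ?(ltW t0)//.
  rewrite -(agree_growth (AB m)) ?growth_rate_expr//.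
  by rewrite addnn -geq_half_double.
have q0 : 0 < (growth_rate_of R A * t) ^+ m./2 by rewrite exprn_gt0// (lt_trans ltr01).
have W0 := lt_le_trans q0 lbW.
have -> : inv_growth (B m) n finset.setT t = (fine (growth_series (@setT (B m)) t))^-1.
  by rewrite -[LHS](mulfK (lt0r_neq0 W0)) WF mul1r.
by rewrite invr_ge0 (ltW W0)/= exprVn lef_pV2.
Qed.

End Limit.

Lemma growth_rate_lower_semicontinuous A (c : R) : coxeter_like A ->
  1 <= c -> c < growth_rate_of R A ->
  exists m, forall B, coxeter_like B -> agree A B m -> c < growth_rate_of R B.
Proof.
move=> coxA c1 cA; apply: contrapT => /forallNP noM.
(* If no radius works, there is a counterexample [B m] for every [m]: a sequence converging to [A]
   with rates at most [c]. *)
have /choice[B BP] : forall m, exists B,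
    [/\ coxeter_like B, agree A B m & growth_rate_of R B <= c].
  move=> m; have := noM m => /existsNP[B] /not_implyP[coxB] /not_implyP[ABm].
  by move=> /negP; rewrite -leNgt; exists B.
have coxB m : coxeter_like (B m) by have [] := BP m.
have AB m : agree A (B m) m by have [] := BP m.
have rateB m : growth_rate_of R (B m) <= c by have [] := BP m.
have c0 : 0 < c by exact: lt_le_trans c1.
have A0 : 0 < growth_rate_of R A by exact: lt_trans cA.
have ab : (growth_rate_of R A)^-1 < c^-1 by rewrite ltf_pV2.
have [P [Q PQ]] := inv_growth_rational n finset.setT coxA.
(* The hypothesis [1 <= c] places the whole interval between the two inverses inside [(0, 1)], where
   the rational form is valid. *)
have P0 : P = 0.
  apply: (poly_eq0_itv ab) => t /andP[at_ tb].
  have t0 : 0 < t by apply: lt_trans at_; rewrite invr_gt0.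
  have ct : c * t < 1 by rewrite -ltr_pdivlMl// mulr1.
  have t1 : t < 1 by apply: lt_le_trans tb _; rewrite invf_le1.
  have At : 1 < growth_rate_of R A * t by rewrite -ltr_pdivrMl// mulr1.
  have t01 : 0 <= t < 1 by rewrite ltW.
  have := inv_growth_limit_eq0 coxA coxB AB rateB (introT andP (conj t0 t1)) ct At.
  have [Q0 ->] := PQ t t01.
  by move/eqP; rewrite mulf_eq0 invr_eq0 (negPf Q0) orbF => /eqP.
have [eta etaP] := coxA.
(* At [0] the inverse growth series times the series equals [1], which is incompatible with a zero
   numerator. *)
have z01 : 0 <= (0 : R) < 1 :> bool by rewrite lexx ltr01.
have /(inv_growth_full etaP z01) : (growth_series (@setT A) (0 : R) < +oo)%E.
  by apply: growth_series_lty => //; rewrite mulr0.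
have [_ ->] := PQ 0 z01.
by rewrite P0 horner0 !mul0r => /esym/eqP; rewrite oner_eq0.
Qed.

Lemma growth_rate_upper_semicontinuous A (c : R) : growth_rate_of R A < c ->
  exists m, forall B, agree A B m -> growth_rate_of R B < c.
Proof.
move=> Ac; have /cvgrPdist_lt/(_ (c - growth_rate_of R A)) := @growth_rateP R n A.
(* A single root below [c] bounds the infimum for every group with the same ball size; [N.+1] is
   taken because the index must be positive. *)
rewrite subr_gt0 => /(_ Ac)[N _ /(_ N.+1 (leqnSn N))] /=.
rewrite distrC => /(le_lt_trans (ler_norm _)).
rewrite growth_rate_inf ltrD2r => root_c.
exists (N.+1 + N.+1)%N => B AB; apply: le_lt_trans root_c.
rewrite (agree_growth AB)// growth_rate_inf root_inf_le//; exact: growth_gt0.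
Qed.

End Continuity.

(** * From agreement on balls to the metric topology *)

(** Agreement passes to smaller radii, so failure at [m] bounds the radius of agreement by [m] and
    the distance from below by [e^-m]. *)
Lemma marked_dist_agree (R : realType) n (A B : markedGroup n) (m : nat) :
  marked_dist R A B < expR (- m%:R) -> agree A B m.
Proof.
apply: contraPP => nAB; apply/negP; rewrite -leNgt.
rewrite -lee_fin /marked_dist fineK ?expeR_agree_fin//.
rewrite -[(expR _)%:E]/(expeR (- m%:R)%:E) lee_expeR EFinN leeN2.
apply: ge_ereal_sup => _ [k ABk <-]; rewrite lee_fin ler_nat leqNgt.
by apply/negP => /ltnW mk; apply/nAB/(agree_le mk).
Qed.

Lemma growth_rate_locally_close (R : realType) n (A : markedGroup n) (e : R) :
  coxeter_like A -> 0 < e ->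
  exists m, forall B, coxeter_like B -> agree A B m ->
    `|growth_rate_of R A - growth_rate_of R B| < e.
Proof.
move=> coxA e0.
have [|mu upper] := @growth_rate_upper_semicontinuous R n A (growth_rate_of R A + e).
  by rewrite ltrDl.
have [ml lower] : exists m, forall B, coxeter_like B -> agree A B m ->
    growth_rate_of R A - e < growth_rate_of R B.
  (* Lower semicontinuity needs a threshold of at least [1]; below that, the bound holds because
     every growth rate is at least [1]. *)
  have [A1|A1] := ltP (growth_rate_of R A - e) 1.
    by exists 0%N => B _ _; apply: lt_le_trans A1 (growth_rate_ge1 _ _).
  by apply: growth_rate_lower_semicontinuous => //; rewrite ltrBlDr ltrDl.
exists (maxn mu ml) => B coxB AB; rewrite ltr_distlC.
rewrite lower ?upper//.
  exact: agree_le (leq_maxl _ _) AB.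
exact: agree_le (leq_maxr _ _) AB.
Qed.

Theorem theorem3p5 (R : realType) (n : nat) (n_gt0 : (0 < n)%N) :
  set_fun (coxeter_space R n) [set x : R | 1 <= x] (@growth_rate R n) /\
  {within coxeter_space R n, continuous (@growth_rate R n)}.
Proof.
have coxeterP (M : 'M[option nat]_n) :
    coxeter_matrix M -> coxeter_like (coxeter_system M).
  by move=> coxM; exists (@coxeter_eta n M); exact: coxeter_cocycle.
split=> [_ [M _ ->]|].
  by rewrite /= growth_rateE; exact: growth_rate_ge1.
apply/subspace_continuousP => _ [M /coxeterP coxM ->].
apply/cvgrPdist_lt => e e0.
have [m close] := @growth_rate_locally_close R n _ e coxM e0.
apply/nbhs_ballP; exists (expR (- m%:R)); first exact: expR_gt0.
move=> _ /[swap] -[N /coxeterP coxN ->].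
rewrite ballEmdist /= => dist.
rewrite /from_subspace !growth_rateE.
apply: close => //; apply: marked_dist_agree; rewrite -space_distE.
exact: dist.
Qed.
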